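(* Let $a_{N,T}\ge e$ and set $\lambda_{N,T}=\sqrt{4NT\log(p)^3\log(a_{N,T})^3}$ and $\mu_{N,T}=\sqrt{4T\log(N)^3\log(a_{N,T})^3}$. Let $$t=\frac{\kappa^2}{(s_1+s_2)\left(\frac{\log p}{\log N}\vee\frac{\log N}{\log p}\right)^3}$$ and let $Nt^2\ge1$. Then, under assumptions (A1) and (A2b), $$P\left(\kappa^2_{\Psi_{N,T}}\ge\kappa^2/2\right)\ge P(\tilde{\mathcal{B}}_{N,T})\ge1-A(p^2+Np)e^{-B(t^2N)^{1/3}}$$ for absolute constants $A$ and $B$.
   Context: For $i=1,\dots,N$, $t=1,\dots,T$ let $x_{i,t}=(x_{i,t,1},\dots,x_{i,t,p})'\in\mathbb{R}^p$ be random covariates and $\epsilon_{i,t}$ random errors in the panel model $y_{i,t}=x_{i,t}'\beta^*+c_i^*+\epsilon_{i,t}$ with deterministic $\beta^*\in\mathbb{R}^p$, $c^*\in\mathbb{R}^N$; $p,N\ge e$; $s_1=|\{j:\beta_j^*\ne0\}|$, $s_2=|\{i:c_i^*\neq0\}|$. Put $X_i=(x_{i,1},\dots,x_{i,T})'$, $X=(X_1',\dots,X_N')'$, $\epsilon_i=(\epsilon_{i,1},\dots,\epsilon_{i,T})'$, $D=I_N\otimes\iota$ with $\iota$ the $T\times1$ vector of ones, $Z=(X,D)$, $S=\mathrm{diag}(\sqrt{NT}\,I_p,\sqrt T\,I_N)$, $\Psi_{N,T}=S^{-1}Z'ZS^{-1}$ and $\Gamma=\mathrm{diag}(E(X'X/(NT)),I_N)$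 (block diagonal). $\|\cdot\|$, $\|\cdot\|_{\ell_1}$ are the $\ell_2$- and $\ell_1$-norms; $a\vee b=\max(a,b)$; $\log$ is natural; $v_A$ is the subvector indexed by $A$. For a positive semi-definite $(p+N)\times(p+N)$ matrix $M$ let $\kappa_M^2$ be the minimum of $\delta'M\delta/\|\delta\|^2$ over all $\delta=({\delta^1}',{\delta^2}')'\in\mathbb{R}^{p+N}\setminus\{0\}$ ($\delta^1\in\mathbb{R}^p$, $\delta^2\in\mathbb{R}^N$) and all $R_1\subseteq\{1,\dots,p\}$, $R_2\subseteq\{1,\dots,N\}$ with $|R_1|\le s_1$, $|R_2|\le s_2$ and $\frac{\lambda_{N,T}}{\sqrt{NT}}\|\delta^1_{R_1^c}\|_{\ell_1}+\frac{\mu_{N,T}}{\sqrt T}\|\delta^2_{R_2^c}\|_{\ell_1}\le 3\frac{\lambda_{N,T}}{\sqrt{NT}}\|\delta^1_{R_1}\|_{\ell_1}+3\frac{\mu_{N,T}}{\sqrt T}\|\delta^2_{R_2}\|_{\ell_1}$. Write $\kappa^2=\kappa^2_\Gamma$. $\tilde{\mathcal{B}}_{N,T}=\left\{\max_{1\le i,j\le p+N}|(\Psi_{N,T})_{i,j}-\Gamma_{i,j}|\le\frac{\kappa^2}{32(s_1+s_2)m_{N,T}^2}\right\}$, where $m_{N,T}=\frac{\lambda_{N,T}}{\sqrt N\mu_{N,T}}\vee\frac{\sqrt N\mu_{N,T}}{\lambda_{N,T}}$. (A1): (a) $\{(X_i,\epsilon_i)\}_{i=1}^N$ are independent and identically distributed;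 (b) $X_i$ and $\epsilon_i$ are independent for each $i$; (c) for each $i$, $\{\epsilon_{i,t},\mathcal{F}_{i,t}\}_{t=1}^T$ with $\mathcal{F}_{i,t}=\sigma(\epsilon_{i,1},\dots,\epsilon_{i,t})$ is a martingale difference sequence. (A2b): there are constants $C,K>0$ with $P(|x_{1,t,k}|\ge u)\le\frac12Ke^{-Cu^2}$ and $P(|\epsilon_{1,t}|\ge u)\le\frac12Ke^{-Cu^2}$ for all $u>0$, $1\le t\le T$, $1\le k\le p$. The constants $C,K$ are regarded as fixed; ''absolute constants'' means positive constants that may depend on $C,K$ but on nothing else. *)

(* Defs.v *)
From HB Require Import structures.
From mathcomp Require Import all_boot all_order all_algebra.
From mathcomp Require Import all_classical all_reals all_analysis.

Set Implicit Arguments.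
Unset Strict Implicit.
Unset Printing Implicit Defensive.

Import Order.TTheory GRing.Theory Num.Theory.

Local Open Scope classical_set_scope.
Local Open Scope ring_scope.

Section probability_notions.
Context {d : measure_display} {Omega : measurableType d} {R : realType}.
Variable P : probability Omega R.

Definition mutually_independent {d'} {U : measurableType d'} {I : finType}
    (Y : I -> Omega -> U) : Prop :=
  forall (J : {set I}) (B : I -> set U), (forall i, measurable (B i)) ->
    P (\bigcap_(i in [set` J]) (Y i @^-1` B i)) =
    (\prod_(i in J) P (Y i @^-1` B i))%E.

Definition identically_distributed {d'} {U : measurableType d'} {I : Type}
    (Y : I -> Omega -> U) : Prop :=
  forall (i j : I) (B : set U), measurable B ->
    P (Y i @^-1` B) = P (Y j @^-1` B).

Definition independent2 {d1 d2} {U1 : measurableType d1}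
    {U2 : measurableType d2} (Y1 : Omega -> U1) (Y2 : Omega -> U2) : Prop :=
  forall (B1 : set U1) (B2 : set U2), measurable B1 -> measurable B2 ->
    (P ((Y1 @^-1` B1) `&` (Y2 @^-1` B2)) =
     P (Y1 @^-1` B1) * P (Y2 @^-1` B2))%E.

Definition measurable_wrt (G : set (set Omega)) (Y : Omega -> R) : Prop :=
  preimage_set_system setT Y measurable `<=` G.

(* Z is a version of the conditional expectation E[Y | G]. *)
Definition is_cond_expectation (G : set (set Omega)) (Y Z : Omega -> R) : Prop :=
  [/\ measurable_wrt G Z,
      P.-integrable setT (EFin \o Z) &
      forall A, G A -> (\int[P]_(w in A) (Z w)%:E = \int[P]_(w in A) (Y w)%:E)%E].

(* Times are numbered from 0: the variable e_t lives at stage t.+1 of the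
   filtration F and has conditional mean zero given stage t. *)
Definition martingale_difference {T : nat} (F : nat -> set (set Omega))
    (e : 'I_T -> Omega -> R) : Prop :=
  forall t : 'I_T,
    [/\ measurable_wrt (F t.+1) (e t),
        P.-integrable setT (EFin \o e t) &
        is_cond_expectation (F t) (e t) (cst 0)].

End probability_notions.

Section panel.
Context {d : measure_display} {Omega : measurableType d} {R : realType}.
Variables (P : probability Omega R) (N T p : nat).
(* x i t k is the k-th covariate and eps i t the error of unit i at time t. *)
Variables (x : 'I_N -> 'I_T -> 'I_p -> {RV P >-> R}).
Variables (eps : 'I_N -> 'I_T -> {RV P >-> R}).

Definition panel_model (y : 'I_N -> 'I_T -> Omega -> R)
    (beta : 'cV[R]_p) (c : 'cV[R]_N) : Prop :=
  forall i t w,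
    y i t w = \sum_(k < p) x i t k w * beta k 0 + c i 0 + eps i t w.

(* X_i and eps_i as random elements of R^(T x p) and R^T, which carry the
   product sigma-algebra. *)
Definition covariate_elt (i : 'I_N) (w : Omega) : T.-tuple (p.-tuple R) :=
  [tuple [tuple x i t k w | k < p] | t < T].

Definition error_elt (i : 'I_N) (w : Omega) : T.-tuple R :=
  [tuple eps i t w | t < T].

(* sigma(eps_{i,1}, ..., eps_{i,n}); trivial for n = 0. *)
Definition error_filtration (i : 'I_N) (n : nat) : set (set Omega) :=
  <<s \bigcup_(t in [set t : 'I_T | (t < n)%N])
        preimage_set_system setT (eps i t) measurable >>.

Definition assumption_A1 : Prop :=
  [/\ mutually_independent P (fun i w => (covariate_elt i w, error_elt i w))
        /\ identically_distributed P
             (fun i w => (covariate_elt i w, error_elt i w)),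
      forall i, independent2 P (covariate_elt i) (error_elt i) &
      forall i, martingale_difference P (error_filtration i)
                  (fun t => eps i t)].

(* Only the first unit, whose index is 0 here, is constrained. *)
Definition assumption_A2b (C K : R) : Prop :=
  forall i : 'I_N, i = 0%N :> nat -> forall (t : 'I_T) (u : R), 0 < u ->
    (forall k : 'I_p,
      (P [set w | (u <= `|x i t k w|)%R]
         <= (2^-1 * K * expR (- (C * u ^+ 2)))%:E)%E) /\
    (P [set w | (u <= `|eps i t w|)%R]
         <= (2^-1 * K * expR (- (C * u ^+ 2)))%:E)%E.

Definition unit_design (w : Omega) (i : 'I_N) : 'M[R]_(T, p) :=
  \matrix_(t < T, k < p) x i t k w.

(* The number of rows is \sum_(i < N) T. *)
Definition design (w : Omega) := \mxcol_(i < N) unit_design w i.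

(* I_N (x) iota: in the i-th block of T rows, column i is constantly 1 and the
   other columns vanish. *)
Definition dummies := \mxcol_(i < N) (\matrix_(t < T, j < N) (i == j)%:R : 'M[R]_(T, N)).

Definition full_design (w : Omega) := row_mx (design w) dummies.

Definition scaling : 'M[R]_(p + N) :=
  block_mx (Num.sqrt (N%:R * T%:R))%:M 0 0 (Num.sqrt T%:R)%:M.

Definition Psi (w : Omega) : 'M[R]_(p + N) :=
  invmx scaling *m ((full_design w)^T *m full_design w) *m invmx scaling.

(* E(X'X/(NT)) is taken entrywise; fine is harmless because the sub-Gaussian
   tails make these expectations finite. *)
Definition Gamma : 'M[R]_(p + N) :=
  block_mx
    (\matrix_(j < p, k < p)
       fine ('E_P[fun w => ((N%:R * T%:R)^-1 *:
                            ((design w)^T *m design w)) j k])%E)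
    0 0 1%:M.

End panel.

Section restricted_eigenvalue.
Context {R : realType}.

Definition l2norm {n : nat} (v : 'cV[R]_n) : R :=
  Num.sqrt (\sum_(i < n) v i 0 ^+ 2).

Definition l1norm_on {n : nat} (A : {set 'I_n}) (v : 'cV[R]_n) : R :=
  \sum_(i in A) `|v i 0|.

Definition nb_nonzero {n : nat} (v : 'cV[R]_n) : nat :=
  #|[set i : 'I_n | v i 0 != 0]|.

Definition restricted_cone (N T p : nat) (lam mu : R) (d1 : 'cV[R]_p)
    (d2 : 'cV[R]_N) (R1 : {set 'I_p}) (R2 : {set 'I_N}) : Prop :=
  lam / Num.sqrt (N%:R * T%:R) * l1norm_on (~: R1) d1
    + mu / Num.sqrt T%:R * l1norm_on (~: R2) d2
  <= 3 * (lam / Num.sqrt (N%:R * T%:R)) * l1norm_on R1 d1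
     + 3 * (mu / Num.sqrt T%:R) * l1norm_on R2 d2.

(* kappa_M^2.  For s1 + s2 > 0 the minimum is attained (finitely many closed
   cones, a quotient that is homogeneous of degree 0), so it is the infimum;
   for s1 = s2 = 0 and lam, mu > 0 no vector is admissible and inf set0 = 0. *)
Definition kappa2 (N T p s1 s2 : nat) (lam mu : R) (M : 'M[R]_(p + N)) : R :=
  inf [set q | exists (d1 : 'cV[R]_p) (d2 : 'cV[R]_N)
                 (R1 : {set 'I_p}) (R2 : {set 'I_N}),
    let delta := col_mx d1 d2 in
    [/\ delta != 0, (#|R1| <= s1)%N, (#|R2| <= s2)%N,
        restricted_cone T lam mu d1 d2 R1 R2 &
        q = (delta^T *m M *m delta) 0 0 / l2norm delta ^+ 2]].

Definition mNT (N : nat) (lam mu : R) : R :=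
  Num.max (lam / (Num.sqrt N%:R * mu)) (Num.sqrt N%:R * mu / lam).

End restricted_eigenvalue.

Definition Btilde {d : measure_display} {Omega : measurableType d}
    {R : realType} (P : probability Omega R) (N T p : nat)
    (x : 'I_N -> 'I_T -> 'I_p -> {RV P >-> R})
    (s1 s2 : nat) (lam mu : R) : set Omega :=
  [set w | \big[Num.max/0]_(i < p + N) \big[Num.max/0]_(j < p + N)
             `|Psi x w i j - Gamma x i j|
           <= kappa2 T s1 s2 lam mu (Gamma x)
              / (32 * (s1 + s2)%:R * mNT N lam mu ^+ 2)].

(* Main.v *)
Require Import Defs.
From mathcomp Require Import all_boot all_order all_algebra.
From mathcomp Require Import all_classical all_reals all_analysis.
From mathcomp Require Import measurable_realfun.
From mathcomp Require Import ring lra.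

Set Implicit Arguments.
Unset Strict Implicit.
Unset Printing Implicit Defensive.

Import Order.TTheory GRing.Theory Num.Theory.

Local Open Scope classical_set_scope.
Local Open Scope ring_scope.

(** The difference Psi - Gamma has only two kinds of nonzero entries.  The
    covariate block consists of averages over the N units of the within-unit
    averages T^-1 sum_t x_{i,t,j} x_{i,t,k}, centred at their common mean; the
    mixed block consists of the variables N^(-1/2) T^-1 sum_t x_{i,t,j}.

    Sub-Gaussian tails give E exp (C/2 x^2) <= M with M depending on K only
    ([integral_exp_sqr_le]).  By convexity of the exponential the same bound is
    inherited, uniformly in T, by C/2 times the square of a within-unit mean
    ([unit_mean_moment]) and by C/2 times the absolute value of a within-unit
    Gram entry ([unit_gram_moment]).  Markov's inequality then bounds the mixed
    entries.  For the covariate entries, a finite exponential moment bounds the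
    moment generating function by exp (h m + D h^2) for small h
    ([exp_moment_le]), independence across units multiplies these bounds
    ([integral_prod_le]), and the Chernoff bound ([chernoff_two_sided]) yields
    a Bernstein rate min(t, t^2) N.  When N t^2 >= 1 this dominates
    (t^2 N)^(1/3) ([cube_root_le]), and a union bound over the p^2 + N p
    entries gives the probability estimate.  The threshold in the definition of
    Btilde is exactly t / 32 because m_{N,T}^2 is the cube of
    max(log p / log N, log N / log p) ([mNT_sqr]); t is positive because Gamma
    is positive semi-definite ([Gamma_psd]).

    On Btilde the comparison of restricted eigenvalues is deterministic: on the
    cone the squared l1-norm is at most 16 m_{N,T}^2 (s1 + s2) times the squared
    l2-norm ([cone_l1_le]), so an entrywise perturbation of the matrix by
    kappa^2 / (32 (s1 + s2) m_{N,T}^2) moves every quotient by at most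
    kappa^2 / 2 ([kappa2_half]).  To compare the probabilities one also needs
    the event on kappa2 (Psi) to be measurable, although kappa2 is an infimum
    over an uncountable set; this follows from the Lipschitz dependence of
    kappa2 on the matrix ([kappa2_lipschitz], [measurable_lipschitz_ge]). *)

(** * Quadratic forms and coordinate norms *)

Section quadratic_forms.
Context {R : realType}.

Definition quad {n : nat} (M : 'M[R]_n) (v : 'cV[R]_n) : R :=
  (v^T *m M *m v) 0 0.

Lemma quadE n (M : 'M[R]_n) v :
  quad M v = \sum_j \sum_i M i j * (v i 0 * v j 0).
Proof.
rewrite /quad mxE; apply: eq_bigr => j _; rewrite mxE mulr_suml.
by apply: eq_bigr => i _; rewrite mxE; ring.
Qed.

(** An entrywise bound on M - G is paired with the l1-norm of the vector, since
    the coefficients |v_i| |v_j| sum to its square. *)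
Lemma quad_perturb n (M G : 'M[R]_n) v (e : R) :
    (forall i j, `|M i j - G i j| <= e) ->
  quad G v - e * (\sum_i `|v i 0|) ^+ 2 <= quad M v.
Proof.
move=> MG; rewrite lerBlDr -lerBlDl !quadE -sumrB.
rewrite expr2 mulr_sumr mulr_sumr; apply: ler_sum => j _.
rewrite -sumrB mulr_suml mulr_sumr; apply: ler_sum => i _.
rewrite -mulrBl (le_trans (ler_norm _))// normrM normrM distrC.
by apply: ler_wpM2r => //; rewrite mulr_ge0.
Qed.

(** Cauchy-Schwarz against the constant 1, from 2 f_i f_j <= f_i^2 + f_j^2 summed
    over all pairs. *)
Lemma sqr_sum_le_card (I : finType) (A : {set I}) (f : I -> R) :
  (\sum_(i in A) f i) ^+ 2 <= #|A|%:R * \sum_(i in A) f i ^+ 2.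
Proof.
have -> : #|A|%:R * \sum_(i in A) f i ^+ 2 =
    2^-1 * \sum_(i in A) \sum_(j in A) (f i ^+ 2 + f j ^+ 2).
  under [in RHS]eq_bigr do rewrite big_split/= sumr_const.
  rewrite big_split/= sumr_const sumrMnl.
  by set S := \sum_(i in A) _; rewrite -[S *+ _]mulr_natl; field.
rewrite expr2 mulr_suml mulr_sumr; apply: ler_sum => i _.
rewrite !mulr_sumr; apply: ler_sum => j _.
by have := sqr_ge0 (f i - f j); nra.
Qed.

Lemma l2norm_sqr n (v : 'cV[R]_n) : l2norm v ^+ 2 = \sum_i v i 0 ^+ 2.
Proof. by rewrite sqr_sqrtr// sumr_ge0// => i _; rewrite sqr_ge0. Qed.

Lemma l2norm_gt0 n (v : 'cV[R]_n) : v != 0 -> 0 < l2norm v ^+ 2.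
Proof.
move=> v0; rewrite l2norm_sqr lt_neqAle sumr_ge0 ?andbT; last first.
  by move=> i _; rewrite sqr_ge0.
rewrite eq_sym; apply: contra v0; rewrite psumr_eq0 => [|i _]; last first.
  by rewrite sqr_ge0.
move=> /allP v0; apply/eqP/matrixP => i j; rewrite ord1 mxE.
by apply/eqP; rewrite -sqrf_eq0; apply: v0; rewrite mem_index_enum.
Qed.

Lemma sqr_l1norm_on_le n (A : {set 'I_n}) (v : 'cV[R]_n) (s : nat) :
  (#|A| <= s)%N -> l1norm_on A v ^+ 2 <= s%:R * \sum_i v i 0 ^+ 2.
Proof.
move=> As; apply: (le_trans (sqr_sum_le_card _ _)); apply: ler_pM => //.
- by apply: sumr_ge0 => i _; rewrite sqr_ge0.
- by rewrite ler_nat.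
- under eq_bigr do rewrite real_normK ?num_real//.
  rewrite [leLHS]big_mkcond/=; apply: ler_sum => i _.
  by case: ifP => // _; rewrite sqr_ge0.
Qed.

End quadratic_forms.

(** * Restricted eigenvalues *)

Section restricted_eigenvalues.
Context {R : realType} (N T p s1 s2 : nat) (lam mu : R).
Hypotheses (N_gt0 : (0 < N)%N) (T_gt0 : (0 < T)%N).
Hypotheses (lam_gt0 : 0 < lam) (mu_gt0 : 0 < mu).

Definition admissible (d1 : 'cV[R]_p) (d2 : 'cV[R]_N) : Prop :=
  exists (R1 : {set 'I_p}) (R2 : {set 'I_N}),
    [/\ col_mx d1 d2 != 0, (#|R1| <= s1)%N, (#|R2| <= s2)%N &
        restricted_cone T lam mu d1 d2 R1 R2].

Definition quotients (M : 'M[R]_(p + N)) : set R :=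
  [set q | exists d1 d2, admissible d1 d2 /\
     q = quad M (col_mx d1 d2) / l2norm (col_mx d1 d2) ^+ 2].

(** The sets R1 and R2 do not occur in the quotient itself, so they can be hidden
    in the admissibility of the direction. *)
Lemma kappa2E (M : 'M[R]_(p + N)) :
  kappa2 T s1 s2 lam mu M = inf (quotients M).
Proof.
congr inf; apply/seteqP; split => q /=.
  by move=> [d1 [d2 [R1 [R2 [? ? ? ? ?]]]]]; exists d1, d2; split => //; exists R1, R2.
by move=> [d1 [d2 [[R1 [R2 [? ? ? ?]]] ?]]]; exists d1, d2, R1, R2.
Qed.

Lemma sum_col_mx (f : R -> R) (d1 : 'cV[R]_p) (d2 : 'cV[R]_N) :
  \sum_i f (col_mx d1 d2 i 0) = \sum_i f (d1 i 0) + \sum_i f (d2 i 0).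
Proof.
by rewrite big_split_ord/=; congr (_ + _); apply: eq_bigr => i _;
  rewrite ?col_mxEu ?col_mxEd.
Qed.

Lemma sum_norm_split n (A : {set 'I_n}) (v : 'cV[R]_n) :
  \sum_i `|v i 0| = l1norm_on A v + l1norm_on (~: A) v.
Proof.
rewrite /l1norm_on (bigID (mem A))/=; congr (_ + _).
by apply: eq_bigl => i; rewrite inE.
Qed.

Lemma l1norm_on_ge0 n (A : {set 'I_n}) (v : 'cV[R]_n) : 0 <= l1norm_on A v.
Proof. exact: sumr_ge0. Qed.

(** Hence [mNT] bounds the ratio of the two weights of the cone condition in both
    directions. *)
Lemma weight_ratio :
  (lam / Num.sqrt (N%:R * T%:R)) / (mu / Num.sqrt T%:R) =
  lam / (Num.sqrt N%:R * mu).
Proof.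
rewrite sqrtrM ?ler0n//; field.
by rewrite !gt_eqF// ?sqrtr_gt0 ?ltr0n.
Qed.

(** With weights w1, w2 of the two blocks, the cone condition bounds the weighted
    l1-norm by 4 times its part on the supports R1, R2.  Dropping the weights
    costs the factor m = max(w1/w2, w2/w1), and Cauchy-Schwarz on the at most
    s1 + s2 support coordinates brings in the l2-norm. *)
Lemma cone_l1_le (d1 : 'cV[R]_p) (d2 : 'cV[R]_N) : admissible d1 d2 ->
  (\sum_i `|col_mx d1 d2 i 0|) ^+ 2 <=
    16 * mNT N lam mu ^+ 2 * (s1 + s2)%:R * l2norm (col_mx d1 d2) ^+ 2.
Proof.
move=> [R1 [R2 [_ R1s R2s]]]; rewrite /restricted_cone.
have w1_gt0 : 0 < lam / Num.sqrt (N%:R * T%:R).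
  by rewrite divr_gt0// sqrtr_gt0 mulr_gt0 ?ltr0n.
have w2_gt0 : 0 < mu / Num.sqrt T%:R by rewrite divr_gt0// sqrtr_gt0 ltr0n.
have := weight_ratio; set w1 := lam / _ in w1_gt0 *.
set w2 := mu / _ in w2_gt0 * => w12.
have m1 : w1 <= mNT N lam mu * w2.
  by rewrite -ler_pdivrMr// w12 /mNT le_max lexx.
have m2 : w2 <= mNT N lam mu * w1.
  rewrite -ler_pdivrMr// /mNT le_max; apply/orP; right.
  by rewrite -[w2 / w1]invf_div w12 invf_div lexx.
rewrite l2norm_sqr (sum_col_mx (fun r => `|r|)) (sum_col_mx (fun r => r ^+ 2)).
rewrite (sum_norm_split R1) (sum_norm_split R2).
have := sqr_l1norm_on_le d1 R1s; have := sqr_l1norm_on_le d2 R2s.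
have := l1norm_on_ge0 R1 d1; have := l1norm_on_ge0 R2 d2.
have := l1norm_on_ge0 (~: R1) d1; have := l1norm_on_ge0 (~: R2) d2.
have : 0 <= \sum_i d1 i 0 ^+ 2 by apply: sumr_ge0 => i _; rewrite sqr_ge0.
have : 0 <= \sum_i d2 i 0 ^+ 2 by apply: sumr_ge0 => i _; rewrite sqr_ge0.
set m := mNT N lam mu in m1 m2 *.
set D1 := \sum_i d1 i 0 ^+ 2; set D2 := \sum_i d2 i 0 ^+ 2.
set a1 := l1norm_on R1 d1; set a2 := l1norm_on R2 d2.
set b1 := l1norm_on _ d1; set b2 := l1norm_on _ d2.
move=> D2_ge0 D1_ge0 b2_ge0 b1_ge0 a2_ge0 a1_ge0 le2 le1 cone.
have m_gt0 : 0 < m by nra.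
have l1_le : a1 + b1 + (a2 + b2) <= 4 * m * (a1 + a2).
  have [w1w2|w2w1] := leP w1 w2.
    rewrite -(ler_pM2l w1_gt0); nra.
  rewrite -(ler_pM2l w2_gt0); nra.
have a_le : (a1 + a2) ^+ 2 <= (s1 + s2)%:R * (D1 + D2).
  (* The cross term of (a1 + a2)^2 is absorbed by the two cross products of
     (s1 + s2) (D1 + D2), by the inequality of means. *)
  have aa : 2 * (a1 * a2) <= s1%:R * D2 + s2%:R * D1.
    rewrite -(@ler_pXn2r _ 2)// ?nnegrE; [|nra|]; last first.
      by rewrite addr_ge0// mulr_ge0// ler0n.
    have : a1 ^+ 2 * a2 ^+ 2 <= (s1%:R * D1) * (s2%:R * D2).
      by apply: ler_pM; rewrite ?sqr_ge0.
    by have := sqr_ge0 (s1%:R * D2 - s2%:R * D1); nra.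
  rewrite natrD; nra.
apply: (@le_trans _ _ ((4 * m * (a1 + a2)) ^+ 2)).
  by rewrite ler_pXn2r// nnegrE; nra.
rewrite -[leRHS]mulrA (_ : _ ^+ 2 = 16 * m ^+ 2 * (a1 + a2) ^+ 2); last by ring.
by apply: ler_wpM2l a_le; rewrite mulr_ge0// sqr_ge0.
Qed.

Lemma quad_norm_le n (M : 'M[R]_n) (v : 'cV[R]_n) :
  `|quad M v| <= (\sum_j \sum_i `|M i j|) * l2norm v ^+ 2.
Proof.
rewrite quadE l2norm_sqr mulr_suml (le_trans (ler_norm_sum _ _ _))//.
apply: ler_sum => j _; rewrite mulr_suml (le_trans (ler_norm_sum _ _ _))//.
apply: ler_sum => i _; rewrite normrM ler_wpM2l//.
have vi k : v k 0 ^+ 2 <= \sum_k v k 0 ^+ 2.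
  rewrite (bigD1 k)//= lerDl sumr_ge0// => l _; exact: sqr_ge0.
have := vi i; have := vi j; rewrite normrM.
rewrite -(real_normK (num_real (v i 0))) -(real_normK (num_real (v j 0))).
have := sqr_ge0 (`|v i 0| - `|v j 0|); nra.
Qed.

Lemma quotients_lbound (M : 'M[R]_(p + N)) : has_lbound (quotients M).
Proof.
exists (- \sum_j \sum_i `|M i j|) => q [d1 [d2 [[R1 [R2 [nz _ _ _]]] ->]]].
rewrite ler_pdivlMr ?l2norm_gt0// mulNr lerNl.
by rewrite (le_trans _ (quad_norm_le _ _))// -normrN ler_norm.
Qed.

Lemma kappa2_le_quotient (M : 'M[R]_(p + N)) q :
  quotients M q -> kappa2 T s1 s2 lam mu M <= q.
Proof. by move=> Mq; rewrite kappa2E ge_inf//; exact: quotients_lbound. Qed.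

(** Transfer of lower bounds from one matrix to another.  The sign of e matters
    when no direction is admissible: both infima are then 0. *)
Lemma le_kappa2 (M G : 'M[R]_(p + N)) (e : R) :
    (forall d1 d2, admissible d1 d2 ->
      quad G (col_mx d1 d2) - e * l2norm (col_mx d1 d2) ^+ 2
        <= quad M (col_mx d1 d2)) -> 0 <= e ->
  kappa2 T s1 s2 lam mu G - e <= kappa2 T s1 s2 lam mu M.
Proof.
move=> GM e_ge0; rewrite [leRHS]kappa2E.
have [[q Mq]|/set0P/negP/negPn/eqP] := pselect (quotients M !=set0).
  apply: lb_le_inf; first by exists q.
  move=> r [d1 [d2 [dd ->]]]; have [R1 [R2 [nz _ _ _]]] := dd.
  rewrite ler_pdivlMr ?l2norm_gt0// (le_trans _ (GM _ _ dd))//.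
  rewrite mulrBl lerB// -ler_pdivlMr ?l2norm_gt0//.
  by apply: kappa2_le_quotient; exists d1, d2.
move=> M0; suff G0 : quotients G = set0.
  by rewrite kappa2E M0 G0 inf0 sub0r oppr_le0.
apply/seteqP; split => // r [d1 [d2 [dd _]]].
suff : quotients M (quad M (col_mx d1 d2) / l2norm (col_mx d1 d2) ^+ 2).
  by rewrite M0.
by exists d1, d2.
Qed.

(** The quotient is linear in the matrix with coefficients of absolute value at
    most 1, and an infimum of uniformly Lipschitz functions is Lipschitz. *)
Lemma kappa2_lipschitz (M G : 'M[R]_(p + N)) :
  kappa2 T s1 s2 lam mu G - \sum_j \sum_i `|M i j - G i j|
    <= kappa2 T s1 s2 lam mu M.
Proof.
apply: le_kappa2; last first.
  by apply: sumr_ge0 => j _; apply: sumr_ge0.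
move=> d1 d2 _.
rewrite lerBlDr -lerBlDl.
apply: (le_trans _ (le_trans (quad_norm_le (G - M) (col_mx d1 d2)) _)).
  apply: le_trans (ler_norm _); rewrite !quadE -sumrB; apply: ler_sum => j _.
  by rewrite -sumrB; apply: ler_sum => i _; rewrite !mxE mulrBl.
apply: ler_wpM2r; first exact: sqr_ge0.
by apply: ler_sum => j _; apply: ler_sum => i _; rewrite !mxE distrC.
Qed.

Lemma kappa2_half (M G : 'M[R]_(p + N)) : (0 < s1 + s2)%N ->
    (forall i j, `|M i j - G i j| <= kappa2 T s1 s2 lam mu G
        / (32 * (s1 + s2)%:R * mNT N lam mu ^+ 2)) ->
    0 <= kappa2 T s1 s2 lam mu G ->
  kappa2 T s1 s2 lam mu G / 2 <= kappa2 T s1 s2 lam mu M.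
Proof.
move=> s_gt0 MG k_ge0.
rewrite (_ : _ / 2 = kappa2 T s1 s2 lam mu G - kappa2 T s1 s2 lam mu G / 2); last first.
  by field.
apply: le_kappa2; last by rewrite divr_ge0.
move=> d1 d2 dd; apply: le_trans (quad_perturb _ MG).
rewrite lerB// (le_trans (ler_wpM2l _ (cone_l1_le dd)))//.
  by rewrite divr_ge0// mulr_ge0 ?sqr_ge0// mulr_ge0// ler0n.
have : (s1 + s2)%:R != 0 :> R by rewrite pnatr_eq0 -lt0n.
have : mNT N lam mu != 0.
  rewrite gt_eqF// /mNT lt_max; apply/orP; left.
  by rewrite divr_gt0// mulr_gt0// sqrtr_gt0 ltr0n.
set s := (s1 + s2)%:R; set m := mNT N lam mu => m0 s0.
by rewrite le_eqVlt; apply/orP; left; apply/eqP; field; rewrite m0 -natrD.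
Qed.

Lemma kappa2_ge0 (M : 'M[R]_(p + N)) :
  (forall v, 0 <= quad M v) -> 0 <= kappa2 T s1 s2 lam mu M.
Proof.
move=> M_ge0; rewrite kappa2E.
have [[q Mq]|/set0P/negP/negPn/eqP ->] := pselect (quotients M !=set0).
  apply: lb_le_inf; first by exists q.
  by move=> r [d1 [d2 [_ ->]]]; rewrite divr_ge0// sqr_ge0.
by rewrite inf0.
Qed.

End restricted_eigenvalues.

(** * Measurability of Lipschitz functions of a random matrix *)

Lemma rat_mx_approx (R : realType) n (M : 'M[R]_n) (e : R) : 0 < e ->
  exists Q : 'M[rat]_n,
    \sum_j \sum_i `|M i j - map_mx ratr Q i j| <= e.
Proof.
move=> e_gt0; pose e' := e / (n * n).+1%:R.
have e'_gt0 : 0 < e' by rewrite divr_gt0.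
have ex i j : exists q : rat, `|M i j - ratr q| <= e'.
  have [q] := @rat_in_itvoo R (M i j - e') (M i j + e') ltac:(lra).
  rewrite in_itv/= => /andP[q1 q2]; exists q; rewrite ler_norml; apply/andP; lra.
exists (\matrix_(i, j) projT1 (cid (ex i j))).
apply: (@le_trans _ _ (\sum_(j < n) \sum_(i < n) e')).
  apply: ler_sum => j _; apply: ler_sum => i _; rewrite !mxE.
  by case: cid.
rewrite !sumr_const card_ord -mulrnA -mulr_natr /e' mulrAC ler_pdivrMr//.
by rewrite ler_pM2l// ler_nat.
Qed.

(** A Lipschitz function is the infimum, over rational matrices Q, of
    g (Q) + dist (., Q), the dense form of McShane's formula.  The superlevel set is
    therefore a countable intersection of measurable sets. *)
Lemma measurable_lipschitz_ge d (Om : measurableType d) (R : realType) n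
    (F : Om -> 'M[R]_n) (g : 'M[R]_n -> R) (c : R) :
    (forall i j, measurable_fun setT (fun w => F w i j)) ->
    (forall M G : 'M[R]_n, g G - \sum_j \sum_i `|M i j - G i j| <= g M) ->
  measurable [set w | c <= g (F w)].
Proof.
move=> mF gL.
pose bad (Q : 'M[rat]_n) := [set w | g (map_mx ratr Q)
  + \sum_j \sum_i `|F w i j - map_mx ratr Q i j| < c].
have -> : [set w | c <= g (F w)] = ~` (\bigcup_Q bad Q).
  apply/seteqP; split => w /=.
    move=> cg [Q _]; rewrite /bad/= ltNge => /negP; apply.
    rewrite (le_trans cg)// -lerBlDr (le_trans _ (gL _ (F w)))// lerB//.
    by apply: ler_sum => j _; apply: ler_sum => i _; rewrite distrC.
  move=> nbad; rewrite leNgt; apply/negP => gc; apply: nbad.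
  have [Q hQ] := rat_mx_approx (F w) (e := (c - g (F w)) / 4) ltac:(lra).
  by exists Q => //; rewrite /bad/=; have := gL (F w) (map_mx ratr Q); lra.
apply: measurableC; apply: countable_bigcupT_measurable => // Q.
rewrite (_ : bad Q = ~` [set w | c <= g (map_mx ratr Q)
    + \sum_j \sum_i `|F w i j - map_mx ratr Q i j|]); last first.
  by apply/seteqP; split => w /=; rewrite /bad/= ltNge => /negP.
apply: measurableC; rewrite -[X in measurable X]setTI.
apply: measurable_fun_le => //.
apply: measurable_funD => //; apply: measurable_sum => j.
apply: measurable_sum => i; apply: measurableT_comp => //.
exact: measurable_funB.
Qed.

(** * Products of independent random elements *)

Section product_limit.
Import numFieldNormedType.Exports.

Lemma cvg_bigprod (R : realType) (I : Type) (r : seq I) (u : I -> nat -> R)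
    (l : I -> R) :
    (forall i, u i n @[n --> \oo] --> l i) ->
  (\prod_(i <- r) u i n) @[n --> \oo] --> \prod_(i <- r) l i.
Proof.
move=> ul; elim: r => [|i r ih].
  rewrite big_nil (_ : (fun n => _) = cst 1); first exact: cvg_cst.
  by apply/funext => n; rewrite big_nil.
rewrite big_cons (_ : (fun n => _) = u i \* (fun n => \prod_(i <- r) u i n)).
  exact: cvgM.
by apply/funext => n; rewrite big_cons.
Qed.

End product_limit.

Section simple_functions.
Import HBNNSimple finmap.

Lemma nnsfun_sum_indic d' (U : measurableType d') (R : realType)
    (phi : {nnsfun U >-> R}) :
  exists m (a : 'I_m -> R) (B : 'I_m -> set U),
    [/\ forall k, 0 <= a k, forall k, measurable (B k) &
        forall u, phi u = \sum_k a k * \1_(B k) u].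
Proof.
pose s := fset_set (range phi).
exists #|` s|, (fun k => s`_k), (fun k => phi @^-1` [set s`_k]).
split=> [k|//|u]; last exact: fimfunEord.
have : s`_k \in s by exact: (mem_nth 0 (ltn_ord k)).
by rewrite in_fset_set// in_setE => -[u _ <-].
Qed.

End simple_functions.

Section independent_products.
Import HBNNSimple numFieldNormedType.Exports.
Context {d : measure_display} {Om : measurableType d} {R : realType}.
Context {d' : measure_display} {U : measurableType d'}.
Variables (P : probability Om R) (I : finType) (Y : I -> Om -> U).
Hypothesis mY : forall i, measurable_fun setT (Y i).
Hypothesis indepY : mutually_independent P Y.

(** For simple functions of independent elements the product expands, by
    distributivity, into products of indicators, to which the product rule for
    events applies term by term. *)
Lemma integral_prod_simple m (a : 'I_m -> R) (B : 'I_m -> set U) :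
    (forall k, 0 <= a k) -> (forall k, measurable (B k)) ->
  (\int[P]_w (\prod_i \sum_k a k * \1_(B k) (Y i w))%:E =
    (\prod_i \sum_k a k * fine (P (Y i @^-1` B k)))%:E)%E.
Proof.
move=> a_ge0 mB.
pose D (f : {ffun I -> 'I_m}) : set Om :=
  \bigcap_(i in [set` [set: I]%SET]) (Y i @^-1` B (f i)).
have mYB i k : measurable (Y i @^-1` B k) by rewrite -[X in measurable X]setTI; exact: mY.
have mD f : measurable (D f) by apply: fin_bigcap_measurable => //.
transitivity (\int[P]_w \sum_(f : {ffun I -> 'I_m})
    ((\prod_i a (f i)) * \1_(D f) w)%:E)%E.
  apply: eq_integral => w _; rewrite bigA_distr_bigA sumEFin; congr EFin.
  apply: eq_bigr => f _; rewrite big_split/=; congr (_ * _).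
  rewrite indicE /D; case: (boolP (w \in _)) => [|].
    rewrite inE => Dw; rewrite big1// => i _.
    by rewrite indicE mem_set//; apply: (Dw i); rewrite /= inE.
  move/negP; rewrite inE => Dw.
  have [i nBi] : exists i, ~ B (f i) (Y i w).
    by apply/existsNP => H; apply: Dw => i _; exact: H.
  by rewrite (bigD1 i)//= indicE memNset// mul0r.
rewrite ge0_integral_sum//; first last.
- by move=> f w _; rewrite lee_fin mulr_ge0// prodr_ge0.
- by move=> f; apply/measurable_EFinP; apply: measurable_funM.
rewrite bigA_distr_bigA -sumEFin; apply: eq_bigr => f _.
under eq_integral do rewrite EFinM.
rewrite ge0_integralZl_EFin//; last 2 first.
- exact/measurable_EFinP.
- exact: prodr_ge0.
rewrite integral_indic// setIT.
rewrite [X in (_ * X)%E](_ : _ =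
    (\prod_(i in [set: I]%SET) P (Y i @^-1` B (f i)))%E); last first.
  by apply: (@indepY [set: I]%SET (B \o f)) => i /=.
rewrite big_split/= EFinM; congr (_ * _)%E.
under eq_bigl do rewrite inE.
rewrite -prodEFin; apply: eq_bigr => i _.
by rewrite fineK// fin_num_measure.
Qed.

Lemma integral_simple m (a : 'I_m -> R) (B : 'I_m -> set U) i :
    (forall k, 0 <= a k) -> (forall k, measurable (B k)) ->
  (\int[P]_w (\sum_k a k * \1_(B k) (Y i w))%:E =
    (\sum_k a k * fine (P (Y i @^-1` B k)))%:E)%E.
Proof.
move=> a_ge0 mB.
have mYB k : measurable (Y i @^-1` B k).
  by rewrite -[X in measurable X]setTI; exact: mY.
under eq_integral do rewrite -sumEFin.
rewrite ge0_integral_sum//; first last.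
- by move=> k w _; rewrite lee_fin mulr_ge0.
- move=> k; apply/measurable_EFinP; apply: measurable_funM => //.
  exact: (measurableT_comp (measurable_indic (mB k)) (mY i)).
rewrite -sumEFin; apply: eq_bigr => k _.
under eq_integral do rewrite EFinM.
rewrite ge0_integralZl_EFin//; last first.
  by apply/measurable_EFinP; exact: (measurableT_comp (measurable_indic (mB k)) (mY i)).
rewrite EFinM fineK ?fin_num_measure//; congr (_ * _)%E.
transitivity (\int[P]_w (\1_(Y i @^-1` B k) w)%:E)%E; first exact: eq_integral.
by rewrite integral_indic// setIT.
Qed.

(** Only the upper bound is proved, which lets the passage from simple functions to
    g use monotone convergence on the left-hand side alone. *)
Lemma integral_prod_le (g : U -> R) (c : R) :
    measurable_fun setT g -> (forall u, 0 <= g u) ->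
    (forall i, \int[P]_w (g (Y i w))%:E <= c%:E)%E ->
  (\int[P]_w (\prod_i g (Y i w))%:E <= (c ^+ #|I|)%:E)%E.
Proof.
move=> mg g_ge0 gc.
have mEg : measurable_fun setT (EFin \o g) by exact/measurable_EFinP.
pose phi := nnsfun_approx measurableT mEg.
have phi_cvg u : (phi n u)%:E @[n --> \oo] --> (g u)%:E.
  by apply: cvg_nnsfun_approx => // v _; rewrite lee_fin.
have phi_nd u : {homo phi ^~ u : m n / (m <= n)%N >-> m <= n}.
  by move=> m n mn; exact/lefP/nd_nnsfun_approx.
have phi_le n u : phi n u <= g u.
  by rewrite -lee_fin nnsfun_approxE; apply: (le_approx (f := EFin \o g)) => // v _; rewrite lee_fin.
have phi_int n : (\int[P]_w (\prod_i phi n (Y i w))%:E <= (c ^+ #|I|)%:E)%E.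
  have mphi : measurable_fun setT (EFin \o phi n) by exact/measurable_EFinP.
  have [m [a [B [a_ge0 mB phiE]]]] := nnsfun_sum_indic (phi n).
  under eq_integral do under eq_bigr do rewrite phiE.
  rewrite integral_prod_simple// lee_fin -prodr_const.
  apply: ler_prod => i _; apply/andP; split.
    by apply: sumr_ge0 => k _; rewrite mulr_ge0// fine_ge0.
  rewrite -lee_fin -integral_simple//; apply: le_trans (gc i).
  under eq_integral do rewrite -phiE.
  apply: ge0_le_integral => //.
  - by move=> w _; rewrite lee_fin.
  - exact: (measurableT_comp mphi (mY i)).
  - exact: (measurableT_comp mEg (mY i)).
  - by move=> w _; rewrite lee_fin.
have prod_cvg w : (\prod_i phi n (Y i w))%:E @[n --> \oo] --> (\prod_i g (Y i w))%:E.
  apply: cvg_EFin; first by apply: nearW.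
  rewrite /= (_ : fine \o _ = fun n => \prod_i phi n (Y i w))//.
  by apply: cvg_bigprod => i; exact: (fine_cvg (phi_cvg (Y i w))).
have int_cvg : (\int[P]_w (\prod_i phi n (Y i w))%:E)%E @[n --> \oo] -->
    (\int[P]_w (\prod_i g (Y i w))%:E)%E.
  rewrite (_ : integral _ _ _ =
      (\int[P]_w limn (fun n => (\prod_i phi n (Y i w))%:E))%E); last first.
    by apply: eq_integral => w _; apply/esym/cvg_lim.
  apply: cvg_monotone_convergence => //.
  - move=> n; apply/measurable_EFinP; apply: measurable_prod => i _.
    exact: (measurableT_comp _ (mY i)).
  - by move=> n w _; rewrite lee_fin prodr_ge0.
  - move=> w _ m n mn; rewrite lee_fin; apply: ler_prod => i _.
    by rewrite phi_nd// andbT.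
rewrite -(cvg_lim _ int_cvg)//; apply: lime_le; last exact: nearW.
by apply: cvgP int_cvg.
Qed.

End independent_products.

(** * Exponential inequalities and sub-Gaussian moments *)

Section exp_inequalities.
Context {R : realType}.
Implicit Types y z : R.

Lemma expR_subr1_le y : expR y - 1 <= y * expR y.
Proof.
have := expR_ge1Dx (- y); rewrite expRN => h.
have e_gt0 := expR_gt0 y.
have : (1 - y) * expR y <= 1.
  by rewrite -ler_pdivlMr// div1r.
lra.
Qed.

(** From exp y - 1 <= y exp y one gets exp y - 1 - y <= y (exp y - 1), and the last
    factor is at most |y| exp |y| in absolute value. *)
Lemma expR_le_quad y : expR y <= 1 + y + y ^+ 2 * expR `|y|.
Proof.
have h1 := expR_subr1_le y; have h2 := expR_ge1Dx y.
suff : y * (expR y - 1) <= y ^+ 2 * expR `|y| by lra.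
have [y0|y0] := leP 0 y; first by rewrite ger0_norm//; nra.
have : 1 <= expR `|y| by rewrite -expR0 ler_expR.
by nra.
Qed.

Lemma sqr_le_expR z : 0 <= z -> z ^+ 2 <= 4 * expR z.
Proof.
move=> z0; have := expR_ge1Dx (z / 2).
have -> : expR z = expR (z / 2) ^+ 2.
  by rewrite expr2 -expRD; congr expR; field.
have := expR_gt0 (z / 2); nra.
Qed.

(** Half of the exponent c |v| pays for the exponential remainder of
    [expR_le_quad], the other half for the factor v^2. *)
Lemma expR_le_affine (c h v : R) : 0 < c -> `|h| <= c / 2 ->
  expR (h * v) <= 1 + h * v + 16 / c ^+ 2 * h ^+ 2 * expR (c * `|v|).
Proof.
move=> c0 hc; apply: (le_trans (expR_le_quad _)).
rewrite lerD2l.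
rewrite (_ : _ * _ = h ^+ 2 * (v ^+ 2 * expR `|h * v|)); last by ring.
rewrite (_ : _ * expR (c * _) = h ^+ 2 * (16 / c ^+ 2 * expR (c * `|v|))); last by ring.
rewrite ler_wpM2l ?sqr_ge0//.
have v0 : 0 <= `|v| by [].
have e1 : expR `|h * v| <= expR (c / 2 * `|v|).
  by rewrite ler_expR normrM ler_wpM2r.
have e2 : v ^+ 2 <= 16 / c ^+ 2 * expR (c / 2 * `|v|).
  have := @sqr_le_expR (c / 2 * `|v|) ltac:(nra).
  rewrite exprMn real_normK ?num_real// => h4.
  have -> : v ^+ 2 = 4 / c ^+ 2 * ((c / 2) ^+ 2 * v ^+ 2) by field; lra.
  have -> : 16 / c ^+ 2 * expR (c / 2 * `|v|) =
    4 / c ^+ 2 * (4 * expR (c / 2 * `|v|)) by field; lra.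
  by rewrite ler_pM2l// divr_gt0// exprn_gt0.
have -> : expR (c * `|v|) = expR (c / 2 * `|v|) * expR (c / 2 * `|v|).
  by rewrite -expRD; congr expR; field.
by rewrite mulrA; apply: ler_pM; rewrite ?sqr_ge0 ?expR_ge0.
Qed.

(** Jensen's inequality for the exponential, by summing the tangent line bound at
    the mean. *)
Lemma expR_mean_le (n : nat) (a : 'I_n -> R) : (0 < n)%N ->
  expR (n%:R^-1 * \sum_t a t) <= n%:R^-1 * \sum_t expR (a t).
Proof.
move=> n0; set b := _ * _.
have nR : 0 < n%:R :> R by rewrite ltr0n.
rewrite ler_pdivlMl//.
have -> : n%:R * expR b = \sum_(t < n) (expR b * (1 + (a t - b))).
  rewrite -mulr_sumr big_split/= sumr_const card_ord sumrB sumr_const card_ord.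
  rewrite -[b *+ n]mulr_natl /b mulrA divff ?gt_eqF// mul1r; ring.
apply: ler_sum => t _; rewrite [X in _ <= expR X](_ : _ = b + (a t - b)); last by ring.
by rewrite expRD ler_wpM2l ?expR_ge0// expR_ge1Dx.
Qed.

End exp_inequalities.

Section moments.
Context {d : measure_display} {Om : measurableType d} {R : realType}.
Variable P : probability Om R.

(** Markov's inequality, with the exponential already normalised into f. *)
Lemma le_prob_integral (A : set Om) (f : Om -> R) : measurable A ->
  measurable_fun setT f -> (forall w, 0 <= f w) -> (forall w, A w -> 1 <= f w) ->
  (P A <= \int[P]_w (f w)%:E)%E.
Proof.
move=> mA mf f0 f1.
have -> : P A = (\int[P]_w (\1_A w)%:E)%E by rewrite integral_indic// setIT.
apply: ge0_le_integral => //.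
- by apply/measurable_EFinP; exact: measurable_indic.
- exact/measurable_EFinP.
move=> w _; rewrite lee_fin indicE; case: (boolP (w \in A)) => //.
by rewrite inE => /f1.
Qed.

(** Slicing C X^2 at the integers: on the slice n <= C X^2 < n + 1 the integrand is
    below exp ((n + 1) / 2), while the slice has probability at most
    (1 + K) exp (- n).  The resulting series is geometric of ratio
    exp (- 1/2). *)
Lemma integral_exp_sqr_le (C K : R) (X : Om -> R) : 0 < C -> 0 < K ->
    measurable_fun setT X ->
    (forall u, 0 < u ->
      (P [set w | (u <= `|X w|)%R] <= (2^-1 * K * expR (- (C * u ^+ 2)))%:E)%E) ->
  (\int[P]_w (expR (C / 2 * X w ^+ 2))%:E <=
    (expR 2^-1 * (1 + K) / (1 - expR (- 2^-1)))%:E)%E.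
Proof.
move=> C0 K0 mX tail.
have mX2 : measurable_fun setT (fun w => C * X w ^+ 2).
  by apply: measurable_funM => //; exact: measurable_funX.
pose A n := [set w | (n%:R <= C * X w ^+ 2)%R].
have mA n : measurable (A n).
  rewrite -[A n]setTI; exact: measurable_fun_le.
have PA n : (P (A n) <= ((1 + K) * expR (- n%:R))%:E)%E.
  case: n => [|n].
    apply: (le_trans (probability_le1 _ _)) => //.
    by rewrite lee_fin oppr0 expR0; lra.
  pose u := Num.sqrt (n.+1%:R / C).
  have u0 : 0 < u by rewrite sqrtr_gt0 divr_gt0.
  have u2 : C * u ^+ 2 = n.+1%:R.
    by rewrite sqr_sqrtr ?divr_ge0 ?ltW// mulrC divfK// gt_eqF.
  have -> : A n.+1 = [set w | u <= `|X w|].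
    apply/seteqP; split => w /=; rewrite /A/= -u2 ler_pM2l//.
      by rewrite -(real_normK (num_real (X w))) ler_pXn2r// nnegrE ltW.
    by rewrite -(real_normK (num_real (X w))) ler_pXn2r// nnegrE ltW.
  apply: (le_trans (tail _ u0)); rewrite lee_fin u2 ler_pM2r ?expR_gt0//; lra.
have mE n : measurable_fun setT (fun w => (expR (2^-1 * n.+1%:R) * \1_(A n) w)%:E).
  by apply/measurable_EFinP; apply: measurable_funM.
apply: (@le_trans _ _ (\int[P]_w
    (\sum_(n <oo) (expR (2^-1 * n.+1%:R) * \1_(A n) w)%:E))%E).
  apply: ge0_le_integral => //.
  - apply/measurable_EFinP; apply: measurableT_comp => //.
    by apply: measurable_funM => //; exact: measurable_funX.
  - by apply: ge0_emeasurable_sum => // n w _ _; rewrite lee_fin mulr_ge0 ?expR_ge0.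
  move=> w _; set r := C * X w ^+ 2.
  have r0 : 0 <= r by rewrite mulr_ge0 ?sqr_ge0 ?ltW.
  have /andP[r1 r2] := truncn_itv r0; set k := Num.truncn r in r1 r2.
  apply: (@le_trans _ _
      (\sum_(0 <= n < k.+1) (expR (2^-1 * n.+1%:R) * \1_(A n) w)%:E)%E); last first.
    by apply: nneseries_lim_ge => n _ _; rewrite lee_fin mulr_ge0 ?expR_ge0.
  apply: (@le_trans _ _ (expR (2^-1 * k.+1%:R) * \1_(A k) w)%:E); last first.
    rewrite big_nat_recr//=; apply: leeDr; apply: sume_ge0 => n _.
    by rewrite lee_fin mulr_ge0 ?expR_ge0.
  rewrite indicE mem_set//= mulr1 lee_fin ler_expR.
  rewrite (_ : C / 2 * X w ^+ 2 = 2^-1 * r); last by rewrite /r; field.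
  by rewrite ler_pM2l// ltW.
rewrite integral_nneseries//.
pose a := expR 2^-1 * (1 + K); pose z : R := expR (- 2^-1).
apply: (@le_trans _ _ (\sum_(n <oo) (a * z ^+ n)%:E)%E).
  apply: lee_nneseries => n _ //.
    by rewrite integral_ge0// => w _; rewrite lee_fin mulr_ge0 ?expR_ge0.
  under eq_integral do rewrite EFinM.
  rewrite ge0_integralZl_EFin ?expR_ge0//; last exact/measurable_EFinP.
  rewrite integral_indic// setIT.
  apply: (@le_trans _ _ ((expR (2^-1 * n.+1%:R))%:E *
      ((1 + K) * expR (- n%:R))%:E)%E).
    by apply: lee_wpmul2l; [rewrite lee_fin expR_ge0|exact: PA].
  rewrite -EFinM lee_fin /a /z -expRM_natl.
  have e : expR (2^-1 * n.+1%:R) * expR (- n%:R) =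
      expR 2^-1 * expR (n%:R * - 2^-1) :> R.
    by rewrite -!expRD; congr expR; rewrite -natr1; field.
  by rewrite mulrCA e mulrCA mulrA lexx.
have z0 : 0 < z by exact: expR_gt0.
have z1 : `|z| < 1 by rewrite gtr0_norm// expR_lt1; lra.
have a0 : 0 <= a by rewrite mulr_ge0 ?expR_ge0//; lra.
apply: lime_le.
  by apply: is_cvg_nneseries => n _ _; rewrite lee_fin mulr_ge0// exprn_ge0// ltW.
apply: nearW => n; rewrite sumEFin lee_fin.
exact: (geometric_le_lim n a0 z0 z1).
Qed.

End moments.

(** * Moment generating functions and Chernoff bounds *)

Section moment_generating.
Context {d : measure_display} {Om : measurableType d} {R : realType}.
Variable P : probability Om R.
Variables (c M : R) (V : Om -> R).
Hypotheses (c_gt0 : 0 < c) (mV : measurable_fun setT V).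
Hypothesis V_exp : (\int[P]_w (expR (c * `|V w|))%:E <= M%:E)%E.

Lemma measurable_exp_norm : measurable_fun setT (fun w => expR (c * `|V w|)).
Proof.
apply: measurableT_comp => //; apply: measurable_funM => //.
exact: measurableT_comp.
Qed.

Lemma integrable_exp_norm :
  P.-integrable setT (fun w => (expR (c * `|V w|))%:E).
Proof.
apply/integrableP; split.
  by apply/measurable_EFinP; exact: measurable_exp_norm.
under eq_integral do rewrite gee0_abs ?lee_fin ?expR_ge0//.
exact: le_lt_trans V_exp (ltry _).
Qed.

Lemma integrable_of_exp : P.-integrable setT (fun w => (V w)%:E).
Proof.
have intE := integrableZl (measurableT : measurable [set: Om]) c^-1 integrable_exp_norm.
apply: le_integrable intE => //; first exact/measurable_EFinP.
move=> w _; rewrite -EFinM !abse_EFin lee_fin normrM.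
rewrite [X in _ <= X * _]ger0_norm; last by rewrite invr_ge0 ltW.
rewrite ler_pdivlMl//.
rewrite [leRHS]ger0_norm ?expR_ge0//.
by have := expR_ge1Dx (c * `|V w|); lra.
Qed.

(** The first-order term of [expR_le_affine] integrates to h m exactly, so no
    centring of V is required. *)
Lemma exp_moment_le (m h : R) : (\int[P]_w (V w)%:E = m%:E)%E ->
    `|h| <= c / 2 ->
  (\int[P]_w (expR (h * V w))%:E <=
    (expR (h * m + 16 / c ^+ 2 * M * h ^+ 2))%:E)%E.
Proof.
move=> Vm hc; set D := 16 / c ^+ 2.
have D_ge0 : 0 <= D by rewrite divr_ge0 ?sqr_ge0.
have iV := integrable_of_exp.
have i1 : P.-integrable setT (fun w => 1%:E : \bar R).
  exact: finite_measure_integrable_cst.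
have I1 : (\int[P]_w 1%:E = 1%:E)%E.
  transitivity (1%:E * P setT)%E; first exact: integral_cst.
  by rewrite probability_setT mule1.
have ihV := integrableZl (measurableT : measurable [set: Om]) h iV.
have iE := integrableZl (measurableT : measurable [set: Om]) (D * h ^+ 2) integrable_exp_norm.
apply: (@le_trans _ _ (\int[P]_w ((1%:E + h%:E * (V w)%:E) +
    (D * h ^+ 2)%:E * (expR (c * `|V w|))%:E))%E).
  apply: ge0_le_integral => //.
  - apply/measurable_EFinP; apply: measurableT_comp => //.
    exact: measurable_funM.
  - apply: emeasurable_funD; last exact: measurable_int iE.
    by apply: emeasurable_funD => //; exact: measurable_int ihV.
  by move=> w _; rewrite -!EFinM -!EFinD lee_fin expR_le_affine.
rewrite integralD//; last exact: integrableD.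
rewrite integralD// !integralZl//; last exact: integrable_exp_norm.
rewrite I1 Vm -EFinM -EFinD.
apply: (@le_trans _ _ ((1 + h * m)%:E + (D * h ^+ 2)%:E * M%:E)%E).
  apply: leeD => //; apply: lee_wpmul2l => //.
  by rewrite lee_fin mulr_ge0// sqr_ge0.
rewrite -EFinM -EFinD lee_fin (le_trans _ (expR_ge1Dx _))//.
by rewrite mulrAC addrA.
Qed.

End moment_generating.

Section identical_distribution.
Context {d : measure_display} {Om : measurableType d} {R : realType}.
Context {d' : measure_display} {U : measurableType d'}.
Variables (P : probability Om R) (I : Type) (Y : I -> Om -> U).
Hypothesis mY : forall i, measurable_fun setT (Y i).
Hypothesis idY : identically_distributed P Y.

Lemma ge0_integral_identical (f : U -> \bar R) i j :
    measurable_fun setT f -> (forall u, (0 <= f u)%E) ->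
  (\int[P]_w f (Y i w) = \int[P]_w f (Y j w))%E.
Proof.
move=> mf f0.
have pf k : (\int[P]_w f (Y k w) = \int[pushforward P (Y k)]_u f u)%E.
  by rewrite ge0_integral_pushforward.
rewrite !pf; apply: eq_measure_integral => A mA _; exact: idY.
Qed.

Lemma integral_identical (f : U -> \bar R) i j : measurable_fun setT f ->
  (\int[P]_w f (Y i w) = \int[P]_w f (Y j w))%E.
Proof.
move=> mf; rewrite integralE [RHS]integralE.
rewrite -[fun w => f (Y i w)]/(f \o Y i) -[fun w => f (Y j w)]/(f \o Y j).
rewrite (funepos_comp f (Y i)) (funepos_comp f (Y j)).
rewrite (funeneg_comp f (Y i)) (funeneg_comp f (Y j)); congr (_ - _)%E.
  exact: (@ge0_integral_identical f^\+%E i j (measurable_funepos mf) (funepos_ge0 f)).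
exact: (@ge0_integral_identical f^\-%E i j (measurable_funeneg mf) (funeneg_ge0 f)).
Qed.

End identical_distribution.

Section concentration.
Context {d : measure_display} {Om : measurableType d} {R : realType}.
Context {d' : measure_display} {U : measurableType d'}.
Variables (P : probability Om R) (N : nat) (Y : 'I_N -> Om -> U).
Hypothesis N_gt0 : (0 < N)%N.
Hypothesis mY : forall i, measurable_fun setT (Y i).
Hypothesis indepY : mutually_independent P Y.
Variables (g : U -> R) (c M m : R).
Hypotheses (c_gt0 : 0 < c) (mg : measurable_fun setT g).
Hypothesis g_exp : forall i,
  (\int[P]_w (expR (c * `|g (Y i w)|))%:E <= M%:E)%E.
Hypothesis g_mean : forall i, (\int[P]_w (g (Y i w))%:E = m%:E)%E.

Let S w := \sum_i g (Y i w).

Let mS : measurable_fun setT S.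
Proof.
by apply: measurable_sum => i; exact: (measurableT_comp mg (mY i)).
Qed.

(** h may be negative, so that the same bound serves both tails. *)
Lemma chernoff_one_sided (h tau : R) : `|h| <= c / 2 ->
  (P [set w | (N%:R * (h * m + tau) <= h * S w)%R] <=
    (expR (- (N%:R * (tau - 16 / c ^+ 2 * M * h ^+ 2))))%:E)%E.
Proof.
move=> hc; set D := 16 / c ^+ 2 * M.
pose b := expR (- (N%:R * (h * m + tau))).
have mhS : measurable_fun setT (fun w => h * S w) by exact: measurable_funM.
apply: (@le_trans _ _
    (\int[P]_w (b * expR (h * S w))%:E)%E).
  apply: le_prob_integral.
  - by rewrite -[X in measurable X]setTI; apply: measurable_fun_le.
  - by apply: measurable_funM => //; exact: measurableT_comp.
  - by move=> w; rewrite mulr_ge0 ?expR_ge0.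
  - move=> w /= hw; rewrite /b -expRD -[leLHS](@expR0 R) ler_expR; lra.
under eq_integral do rewrite EFinM.
rewrite ge0_integralZl_EFin ?expR_ge0//; last first.
  by apply/measurable_EFinP; exact: measurableT_comp.
have -> : (\int[P]_w (expR (h * S w))%:E =
    \int[P]_w (\prod_i expR (h * g (Y i w)))%:E)%E.
  by apply: eq_integral => w _; rewrite /S mulr_sumr expR_sum.
apply: (@le_trans _ _ (b%:E * (expR (h * m + D * h ^+ 2) ^+ #|'I_N|)%:E)%E).
  apply: lee_wpmul2l; first by rewrite lee_fin expR_ge0.
  apply: (@integral_prod_le _ _ _ _ _ P _ Y mY indepY (fun u => expR (h * g u))).
  - by apply: measurableT_comp => //; exact: measurable_funM.
  - by move=> u; exact: expR_ge0.
  - move=> i; apply: exp_moment_le => //.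
    exact: (measurableT_comp mg (mY i)).
rewrite -EFinM lee_fin card_ord -expRM_natl /b -expRD ler_expR; lra.
Qed.

Lemma chernoff_two_sided (h tau : R) : 0 < h <= c / 2 ->
  (P [set w | (tau <= `|N%:R^-1 * S w - m|)%R] <=
    (2 * expR (- (N%:R * (h * tau - 16 / c ^+ 2 * M * h ^+ 2))))%:E)%E.
Proof.
move=> /andP[h0 hc]; set E := expR _.
have NR : 0 < N%:R :> R by rewrite ltr0n.
pose A s := [set w | N%:R * (s * m + h * tau) <= s * S w].
have mA s : measurable (A s).
  rewrite -[A s]setTI; apply: measurable_fun_le => //.
  exact: measurable_funM.
have PA s : `|s| = h -> (P (A s) <= E%:E)%E.
  move=> sh; apply: (le_trans (chernoff_one_sided _ _)); first by rewrite sh.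
  by rewrite lee_fin /E -(real_normK (num_real s)) sh.
apply: (@le_trans _ _ (P (A h `|` A (- h)))).
  apply: le_measure; rewrite ?inE.
  - rewrite -[X in measurable X]setTI; apply: measurable_fun_le => //.
    apply: measurableT_comp => //; apply: measurable_funB => //.
    exact: measurable_funM.
  - exact: measurableU.
  move=> w /=; rewrite ler_normr => /orP[] h1; [left|right]; rewrite /A/=.
    have : tau + m <= N%:R^-1 * S w by lra.
    rewrite ler_pdivlMl// => h2; rewrite -mulrDr mulrCA ler_pM2l//; lra.
  have : N%:R^-1 * S w <= m - tau by lra.
  rewrite ler_pdivrMl// => h2.
  rewrite (_ : _ * _ = h * (N%:R * (tau - m))); last by ring.
  rewrite (_ : - h * _ = h * - S w); last by ring.
  by rewrite ler_pM2l//; lra.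
apply: (le_trans (measureU2 _ _ _)) => //.
rewrite (_ : 2 * E = E + E); last by ring.
rewrite EFinD; apply: leeD; apply: PA; rewrite ?normrN gtr0_norm//.
Qed.

End concentration.

(** * Blocks of the rescaled Gram matrix *)

Section gram_blocks.
Context {d : measure_display} {Om : measurableType d} {R : realType}.
Variables (P : probability Om R) (N T p : nat).
Variable x : 'I_N -> 'I_T -> 'I_p -> {RV P >-> R}.
Hypotheses (N_gt0 : (0 < N)%N) (T_gt0 : (0 < T)%N).

Definition unit_gram (w : Om) (i : 'I_N) (j k : 'I_p) : R :=
  T%:R^-1 * \sum_t x i t j w * x i t k w.

Definition unit_mean (w : Om) (i : 'I_N) (j : 'I_p) : R :=
  T%:R^-1 * \sum_t x i t j w.

Let NR : N%:R != 0 :> R. Proof. by rewrite pnatr_eq0 -lt0n. Qed.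
Let TR : T%:R != 0 :> R. Proof. by rewrite pnatr_eq0 -lt0n. Qed.
Let rN : Num.sqrt N%:R != 0 :> R.
Proof. by rewrite gt_eqF// sqrtr_gt0 ltr0n. Qed.
Let rT : Num.sqrt T%:R != 0 :> R.
Proof. by rewrite gt_eqF// sqrtr_gt0 ltr0n. Qed.

Lemma design_gramE w : (design x w)^T *m design x w =
  \matrix_(j, k) \sum_i \sum_t x i t j w * x i t k w.
Proof.
apply/matrixP => j k; rewrite [RHS]mxE.
rewrite /design tr_mxcol mul_mxrow_mxcol summxE; apply: eq_bigr => i _.
by rewrite mxE; apply: eq_bigr => t _; rewrite !mxE.
Qed.

Lemma design_dummiesE w :
  (design x w)^T *m @dummies R N T = \matrix_(j, i) \sum_t x i t j w.
Proof.
apply/matrixP => j i; rewrite [RHS]mxE.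
rewrite /design /dummies tr_mxcol mul_mxrow_mxcol summxE (bigD1 i)//=.
rewrite [X in _ + X]big1 ?addr0 => [|l li].
  by rewrite mxE; apply: eq_bigr => t _; rewrite !mxE eqxx mulr1.
by rewrite mxE big1// => t _; rewrite !mxE (negbTE li) mulr0.
Qed.

Lemma dummies_gramE : (@dummies R N T)^T *m @dummies R N T = T%:R%:M.
Proof.
apply/matrixP => i k; rewrite /dummies tr_mxcol mul_mxrow_mxcol summxE (bigD1 i)//=.
rewrite [X in _ + X]big1 ?addr0 => [|l li].
  rewrite mxE (eq_bigr (fun _ => (i == k)%:R)) => [|t _].
    by rewrite sumr_const card_ord !mxE mulrnAC.
  by rewrite !mxE eqxx mul1r.
by rewrite mxE big1// => t _; rewrite !mxE (negbTE li) mul0r.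
Qed.

Lemma invmx_scaling : invmx (@scaling R N T p) =
  block_mx (Num.sqrt (N%:R * T%:R))^-1%:M 0 0 (Num.sqrt T%:R)^-1%:M.
Proof.
set B := block_mx _ _ _ _.
have SB : @scaling R N T p *m B = 1%:M.
  rewrite /scaling /B mulmx_block !mul0mx !mulmx0 !addr0 !add0r -!scalar_mxM.
  by rewrite sqrtrM// !divff ?mulf_neq0// -scalar_mx_block.
have [Su _] := mulmx1_unit SB.
by rewrite -[LHS]mulmx1 -SB mulmxA mulVmx// mul1mx.
Qed.

(** The diagonal scaling turns X'X into an average over all N T observations and
    D'D = T I into the identity; the mixed block keeps a factor N^(-1/2). *)
Lemma PsiE w : Psi x w = block_mx
  (\matrix_(j, k) (N%:R^-1 * \sum_i unit_gram w i j k))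
  (\matrix_(j, i) ((Num.sqrt N%:R)^-1 * unit_mean w i j))
  (\matrix_(i, j) ((Num.sqrt N%:R)^-1 * unit_mean w i j))
  1%:M.
Proof.
rewrite /Psi /full_design tr_row_mx mul_col_row invmx_scaling.
rewrite !mulmx_block !mul0mx !mulmx0 !addr0 !add0r dummies_gramE.
rewrite -[_^T *m design x w in X in block_mx _ _ X _]trmxK trmx_mul trmxK.
rewrite design_gramE design_dummiesE !mul_scalar_mx !mul_mx_scalar.
rewrite sqrtrM//.
have eN : N%:R = Num.sqrt N%:R ^+ 2 :> R by rewrite sqr_sqrtr.
have eT : T%:R = Num.sqrt T%:R ^+ 2 :> R by rewrite sqr_sqrtr.
have nN := rN; have nT := rT.
set sN := Num.sqrt N%:R in nN eN *; set sT := Num.sqrt T%:R in nT eT *.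
congr block_mx.
- apply/matrixP => j k; rewrite !mxE -mulr_sumr eN eT.
  by field; rewrite nN nT.
- by apply/matrixP => j i; rewrite !mxE /unit_mean eT; field; rewrite nN nT.
- by apply/matrixP => i j; rewrite !mxE /unit_mean eT; field; rewrite nN nT.
- by apply/matrixP => i k; rewrite !mxE eT; case: eqP => _;
    rewrite ?mulr1n ?mulr0n; field; rewrite nT.
Qed.

End gram_blocks.

(** * Moments in the panel model *)

Section averages.
Context {d : measure_display} {Om : measurableType d} {R : realType}.
Variable P : probability Om R.

(** Used to make the moment bounds below independent of T. *)
Lemma integral_mean_le n (f : 'I_n -> Om -> R) (M : R) : (0 < n)%N ->
    (forall t, measurable_fun setT (f t)) -> (forall t w, 0 <= f t w) ->
    (forall t, \int[P]_w (f t w)%:E <= M%:E)%E ->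
  (\int[P]_w (n%:R^-1 * \sum_t f t w)%:E <= M%:E)%E.
Proof.
move=> n0 mf f0 fM.
under eq_integral do rewrite EFinM -sumEFin.
rewrite ge0_integralZl_EFin ?invr_ge0//; last 2 first.
- by move=> w _; apply: sume_ge0 => t _; rewrite lee_fin.
- by apply: emeasurable_sum => t; exact/measurable_EFinP.
rewrite ge0_integral_sum//; first last.
- by move=> t w _; rewrite lee_fin.
- by move=> t; exact/measurable_EFinP.
apply: (@le_trans _ _ (n%:R^-1%:E * \sum_(t < n) M%:E)%E).
  apply: lee_wpmul2l; first by rewrite lee_fin invr_ge0.
  by apply: lee_sum => t _.
rewrite sumEFin -EFinM lee_fin sumr_const card_ord -[M *+ n]mulr_natl.
by rewrite mulKf// pnatr_eq0 -lt0n.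
Qed.

Lemma union_bound (I : finType) (A : I -> set Om) (D : set Om) (b : R) :
    measurable D -> (forall i, measurable (A i)) ->
    (forall w, D w -> exists i, A i w) ->
    (forall i, P (A i) <= b%:E)%E ->
  (P D <= (#|I|%:R * b)%:E)%E.
Proof.
move=> mD mA DA Ab.
apply: (@le_trans _ _ (\int[P]_w (\sum_i \1_(A i) w)%:E)%E).
  apply: le_prob_integral => //.
  - by apply: measurable_sum => i; exact: measurable_indic.
  - by move=> w; apply: sumr_ge0.
  move=> w /DA[i Aiw]; rewrite (bigD1 i)//= indicE mem_set// lerDl.
  exact: sumr_ge0.
under eq_integral do rewrite -sumEFin.
rewrite ge0_integral_sum//; last first.
  by move=> i; apply/measurable_EFinP; exact: measurable_indic.
apply: (@le_trans _ _ (\sum_(i : I) b%:E)%E).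
  apply: lee_sum => i _; rewrite integral_indic// setIT; exact: Ab.
by rewrite sumEFin sumr_const mulr_natl.
Qed.

End averages.

Section panel_moments.
Context {d : measure_display} {Om : measurableType d} {R : realType}.
Variables (P : probability Om R) (N T p : nat).
Variables (x : 'I_N -> 'I_T -> 'I_p -> {RV P >-> R}).
Variables (eps : 'I_N -> 'I_T -> {RV P >-> R}).
Variables (C K : R) (i0 : 'I_N).
Hypotheses (T_gt0 : (0 < T)%N) (C_gt0 : 0 < C) (K_gt0 : 0 < K).
Hypothesis i00 : i0 = 0%N :> nat.
Hypotheses (A1 : assumption_A1 x eps) (A2 : assumption_A2b x eps C K).

Definition unit_elt i w := (covariate_elt x i w, error_elt eps i w).
Local Notation Y := unit_elt.

Lemma measurable_unit_elt i : measurable_fun setT (Y i).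
Proof.
apply: measurable_fun_pair; apply/measurable_fun_tnthP => t.
  apply/measurable_fun_tnthP => k.
  rewrite (_ : _ \o _ = x i t k)//; apply/funext => w /=.
  by rewrite !tnth_mktuple.
rewrite (_ : _ \o _ = eps i t)//; apply/funext => w /=.
by rewrite tnth_mktuple.
Qed.

Lemma unit_elt_indep : mutually_independent P Y.
Proof. by case: A1 => -[]. Qed.

Lemma unit_elt_ident : identically_distributed P Y.
Proof. by case: A1 => -[]. Qed.

Definition coord t k (u : T.-tuple (p.-tuple R) * T.-tuple R) : R :=
  tnth (tnth u.1 t) k.

Lemma coordE t k i w : coord t k (Y i w) = x i t k w.
Proof. by rewrite /coord/= !tnth_mktuple. Qed.

Lemma measurable_coord t k : measurable_fun setT (coord t k).
Proof.
exact: (measurableT_comp (measurable_tnth k)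
  (measurableT_comp (measurable_tnth t) measurable_fst)).
Qed.

Let C2_gt0 : 0 < C / 2. Proof. by rewrite divr_gt0. Qed.

(** The bound of [integral_exp_sqr_le], a constant depending on K only. *)
Definition exp_bound : R := expR 2^-1 * (1 + K) / (1 - expR (- 2^-1)).

Lemma exp_bound_gt0 : 0 < exp_bound.
Proof.
apply: divr_gt0; first by apply: mulr_gt0; [exact: expR_gt0|exact: addr_gt0].
by rewrite subr_gt0 expR_lt1; lra.
Qed.

(** The tail assumption concerns the first unit alone; identical distribution
    carries the moment over to every unit. *)
Lemma covariate_moment i t k :
  (\int[P]_w (expR (C / 2 * x i t k w ^+ 2))%:E <= exp_bound%:E)%E.
Proof.
pose f u := (expR (C / 2 * coord t k u ^+ 2))%:E.
have -> : (\int[P]_w (expR (C / 2 * x i t k w ^+ 2))%:E =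
    \int[P]_w f (Y i w))%E.
  by apply: eq_integral => w _; rewrite /f coordE.
rewrite (ge0_integral_identical measurable_unit_elt unit_elt_ident i i0); last 2 first.
- apply/measurable_EFinP; apply: measurableT_comp => //.
  apply: measurable_funM => //; apply: measurable_funX; exact: measurable_coord.
- by move=> u; rewrite lee_fin expR_ge0.
have -> : (\int[P]_w f (Y i0 w) =
    \int[P]_w (expR (C / 2 * x i0 t k w ^+ 2))%:E)%E.
  by apply: eq_integral => w _; rewrite /f coordE.
apply: integral_exp_sqr_le => // u u0.
by have [+ _] := A2 i00 t u0; apply.
Qed.

Let measurable_exp_cov i t k :
  measurable_fun setT (fun w => expR (C / 2 * x i t k w ^+ 2)).
Proof.
apply: measurableT_comp => //; apply: measurable_funM => //.
exact: measurable_funX.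
Qed.

Lemma measurable_unit_mean i k : measurable_fun setT (fun w => unit_mean x w i k).
Proof. by apply: measurable_funM => //; apply: measurable_sum. Qed.

(** The square of a mean is at most the mean of the squares, then Jensen. *)
Lemma unit_mean_moment i k :
  (\int[P]_w (expR (C / 2 * unit_mean x w i k ^+ 2))%:E <= exp_bound%:E)%E.
Proof.
apply: (@le_trans _ _ (\int[P]_w (T%:R^-1 *
    \sum_t expR (C / 2 * x i t k w ^+ 2))%:E)%E); last first.
  by apply: integral_mean_le => // t; exact: covariate_moment.
apply: ge0_le_integral => //.
- apply/measurable_EFinP; apply: measurableT_comp => //.
  apply: measurable_funM => //; apply: measurable_funX.
  exact: measurable_unit_mean.
- apply/measurable_EFinP; apply: measurable_funM => //.
  by apply: measurable_sum.
move=> w _; rewrite lee_fin (le_trans _ (expR_mean_le _ T_gt0))//.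
rewrite ler_expR -mulr_sumr [leRHS]mulrCA ler_pM2l ?divr_gt0//.
rewrite /unit_mean exprMn expr2 -mulrA ler_pM2l ?invr_gt0 ?ltr0n//.
rewrite ler_pdivrMl ?ltr0n//.
have := @sqr_sum_le_card R _ [set: 'I_T]%SET (fun t => x i t k w).
by rewrite cardsT card_ord; under eq_bigl do rewrite inE;
  under [X in _ <= _ * X -> _]eq_bigl do rewrite inE.
Qed.

Definition gram_fun j k (u : T.-tuple (p.-tuple R) * T.-tuple R) : R :=
  T%:R^-1 * \sum_t coord t j u * coord t k u.

Lemma gram_funE j k i w : gram_fun j k (Y i w) = unit_gram x w i j k.
Proof.
by rewrite /gram_fun /unit_gram; congr (_ * _); apply: eq_bigr => t _;
  rewrite !coordE.
Qed.

Lemma measurable_gram_fun j k : measurable_fun setT (gram_fun j k).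
Proof.
apply: measurable_funM => //; apply: measurable_sum => t.
by apply: measurable_funM; exact: measurable_coord.
Qed.

Lemma measurable_unit_gram i j k :
  measurable_fun setT (fun w => unit_gram x w i j k).
Proof.
apply: measurable_funM => //; apply: measurable_sum => t.
exact: measurable_funM.
Qed.

(** C/2 |x_{i,t,j} x_{i,t,k}| is at most the mean of the two variables C/2 x^2, so
    Jensen is used twice: over t, and over the pair (j, k). *)
Lemma unit_gram_moment i j k :
  (\int[P]_w (expR (C / 2 * `|unit_gram x w i j k|))%:E <= exp_bound%:E)%E.
Proof.
(* The index b < 2 selects one of the two covariates. *)
pose f (t : 'I_T) w := 2%:R^-1 * \sum_(b < 2)
  expR (C / 2 * x i t (if b == 0%N :> nat then j else k) w ^+ 2).
have mf t : measurable_fun setT (f t).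
  by apply: measurable_funM => //; apply: measurable_sum => b.
apply: (@le_trans _ _ (\int[P]_w (T%:R^-1 * \sum_t f t w)%:E)%E); last first.
  apply: integral_mean_le => // [t w|t].
    by rewrite mulr_ge0// sumr_ge0// => b _; exact: expR_ge0.
  by apply: integral_mean_le => // b; exact: covariate_moment.
apply: ge0_le_integral => //.
- apply/measurable_EFinP; apply: measurableT_comp => //.
  apply: measurable_funM => //; apply: measurableT_comp => //.
  exact: measurable_unit_gram.
- by apply/measurable_EFinP; apply: measurable_funM => //; apply: measurable_sum.
move=> w _; rewrite lee_fin.
pose a t := 2%:R^-1 * \sum_(b < 2)
  (C / 2 * x i t (if b == 0%N :> nat then j else k) w ^+ 2).
apply: (@le_trans _ _ (expR (T%:R^-1 * \sum_t a t))).
  rewrite ler_expR /unit_gram normrM [leLHS]mulrCA ger0_norm ?invr_ge0//.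
  rewrite ler_wpM2l ?invr_ge0//.
  apply: (le_trans (ler_wpM2l (ltW C2_gt0) (ler_norm_sum _ _ _))).
  rewrite mulr_sumr; apply: ler_sum => t _.
  rewrite /a !big_ord_recl big_ord0/= normrM.
  have := mulr_ge0 (ltW C_gt0) (sqr_ge0 (`|x i t j w| - `|x i t k w|)).
  rewrite -(real_normK (num_real (x i t j w))).
  rewrite -(real_normK (num_real (x i t k w))). nra.
apply: le_trans (expR_mean_le _ T_gt0) _.
by rewrite ler_wpM2l ?invr_ge0//; apply: ler_sum => t _; exact: expR_mean_le.
Qed.

Definition gram_mean j k : R := fine (\int[P]_w (unit_gram x w i0 j k)%:E)%E.

Lemma integrable_unit_gram i j k :
  P.-integrable setT (fun w => (unit_gram x w i j k)%:E).
Proof.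
apply: (@integrable_of_exp _ _ _ _ (C / 2) exp_bound) => //.
  exact: measurable_unit_gram.
exact: unit_gram_moment.
Qed.

(** The units have the same law, so the mean of unit i0 serves for all of them. *)
Lemma unit_gram_meanE i j k :
  (\int[P]_w (unit_gram x w i j k)%:E = (gram_mean j k)%:E)%E.
Proof.
have e i' : (\int[P]_w (unit_gram x w i' j k)%:E =
    \int[P]_w (EFin \o gram_fun j k) (Y i' w))%E.
  by apply: eq_integral => w _; rewrite /= gram_funE.
rewrite /gram_mean fineK ?integrable_fin_num//; last exact: integrable_unit_gram.
rewrite (e i) (e i0).
apply: (integral_identical measurable_unit_elt unit_elt_ident).
by apply/measurable_EFinP; exact: measurable_gram_fun.
Qed.

Lemma GammaE : Gamma x = block_mx (\matrix_(j, k) gram_mean j k) 0 0 1%:M.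
Proof.
have NR : N%:R != 0 :> R.
  by rewrite pnatr_eq0 -lt0n (leq_ltn_trans _ (ltn_ord i0)).
have TR : T%:R != 0 :> R by rewrite pnatr_eq0 -lt0n.
rewrite /Gamma; congr block_mx; apply/matrixP => j k; rewrite !mxE.
rewrite unlock.
transitivity (fine (\int[P]_w (N%:R^-1%:E *
    \sum_i (unit_gram x w i j k)%:E))%E).
  congr fine; apply: eq_integral => w _.
  rewrite mxE design_gramE mxE sumEFin -EFinM; congr EFin.
  by rewrite /unit_gram -mulr_sumr mulrA invfM.
rewrite integralZl//; last first.
  by apply: integrable_sum => // i _; exact: integrable_unit_gram.
rewrite integral_sum//; last by move=> i; exact: integrable_unit_gram.
under eq_bigr do rewrite unit_gram_meanE.
rewrite sumEFin -EFinM/= sumr_const card_ord -[X in _ * X]mulr_natl.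
by rewrite mulKf.
Qed.

(** The covariate block is the matrix of second moments, so its quadratic form is
    the expectation of a mean of squares. *)
Lemma Gamma_psd v : 0 <= quad (Gamma x) v.
Proof.
have := GammaE; rewrite -[v]vsubmxK; set v1 := usubmx v; set v2 := dsubmx v => GE.
have -> : quad (Gamma x) (col_mx v1 v2) =
    \sum_k \sum_j gram_mean j k * (v1 j 0 * v1 k 0) + \sum_i v2 i 0 ^+ 2.
  rewrite /quad GE tr_col_mx mul_row_block !mulmx0 mulmx1 addr0 add0r.
  rewrite mul_row_col mxE; congr (_ + _).
    by rewrite -/(quad _ _) quadE; under eq_bigr do under eq_bigr do rewrite mxE.
  by rewrite mxE; apply: eq_bigr => i _; rewrite mxE expr2.
apply: addr_ge0; last by apply: sumr_ge0 => i _; exact: sqr_ge0.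
rewrite -lee_fin -sumEFin.
have -> : (\sum_k (\sum_j gram_mean j k * (v1 j 0 * v1 k 0))%:E =
   \int[P]_w \sum_k \sum_j (v1 j 0 * v1 k 0)%:E * (unit_gram x w i0 j k)%:E)%E.
  have intZ j k : P.-integrable setT (fun w => (v1 j 0 * v1 k 0)%:E *
      (unit_gram x w i0 j k)%:E)%E.
    by apply: integrableZl => //; exact: integrable_unit_gram.
  rewrite integral_sum//; last by move=> k; apply: integrable_sum.
  apply: eq_bigr => k _; rewrite integral_sum// -sumEFin.
  apply: eq_bigr => j _; rewrite integralZl//; last exact: integrable_unit_gram.
  by rewrite unit_gram_meanE -EFinM mulrC.
apply: integral_ge0 => w _.
have -> : (\sum_k \sum_j (v1 j 0 * v1 k 0)%:E * (unit_gram x w i0 j k)%:E =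
    (T%:R^-1 * \sum_t (\sum_j v1 j 0 * x i0 t j w) ^+ 2)%:E)%E.
  under eq_bigr do under eq_bigr do rewrite -EFinM.
  under eq_bigr do rewrite sumEFin.
  rewrite sumEFin; congr EFin.
  under [in RHS]eq_bigr do rewrite expr2 mulr_sumr.
  rewrite [in RHS]exchange_big/= mulr_sumr; apply: eq_bigr => k _.
  under [in RHS]eq_bigr do rewrite mulr_suml.
  rewrite [in RHS]exchange_big/= mulr_sumr; apply: eq_bigr => j _.
  rewrite /unit_gram mulrCA; congr (_ * _); rewrite mulr_sumr.
  by apply: eq_bigr => t _; ring.
by rewrite lee_fin mulr_ge0 ?invr_ge0// sumr_ge0// => t _; exact: sqr_ge0.
Qed.

End panel_moments.

(** * Rates *)

Section rates.
Context {R : realType}.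

Lemma cube_root (y : R) : 0 <= y -> (y `^ 3^-1) ^+ 3 = y.
Proof.
by move=> y0; rewrite -powR_mulrn ?powR_ge0// -powRrM mulVf// powRr1.
Qed.

(** The Bernstein exponent min(t, t^2) n dominates z = (t^2 n)^(1/3).  If t <= 1 the
    exponent is z^3 >= z; if t > 1 it is t n, whose cube exceeds t^2 n. *)
Lemma cube_root_le (n t z : R) : 0 < t -> 1 <= n -> 0 <= z ->
  z ^+ 3 = t ^+ 2 * n -> 1 <= t ^+ 2 * n -> z <= n * (Num.min 1 t * t).
Proof.
move=> t0 n1 z0 z3 tn1.
have z1 : 1 <= z by rewrite -(@expr_ge1 R 3)// z3.
have [t1|t1] := leP 1 t.
  rewrite mul1r -(@ler_pXn2r R 3)// ?nnegrE; [|by nra].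
  rewrite z3 (_ : (n * t) ^+ 3 = t ^+ 2 * n * (t * n * n)); last by ring.
  by rewrite ler_peMr ?mulr_ege1//; lra.
rewrite (_ : n * _ = z ^+ 3); last by rewrite z3; ring.
by rewrite exprS ler_peMr// expr_ge1.
Qed.

(** The Chernoff exponent h tau - D h^2 at tau = t / 32, with h kept bounded: for
    h = eta min(1, t) and eta D <= 1/64 the quadratic term is at most half of the
    linear one. *)
Lemma gram_rate (n t z eta D : R) : 0 < t -> 1 <= n -> 0 <= z ->
    z ^+ 3 = t ^+ 2 * n -> 1 <= t ^+ 2 * n ->
    0 < eta -> 0 <= D -> eta * D <= 64^-1 ->
  eta / 64 * z <=
    n * (eta * Num.min 1 t * (t / 32) - D * (eta * Num.min 1 t) ^+ 2).
Proof.
move=> t0 n1 z0 z3 tn1 e0 D0 eD.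
have := cube_root_le t0 n1 z0 z3 tn1; set m := Num.min 1 t => zm.
have m0 : 0 < m by rewrite lt_min ltr01 t0.
have mt : m <= t by rewrite ge_min lexx orbT.
have h1 : D * (eta * m) ^+ 2 <= 64^-1 * (eta * (m * t)).
  rewrite (_ : D * _ = (eta * D) * (eta * (m * m))); last by ring.
  apply: ler_pM => //; first by rewrite mulr_ge0// ltW.
    by rewrite !mulr_ge0// ltW.
  by rewrite ler_pM2l// ler_pM2l.
apply: (@le_trans _ _ (n * (64^-1 * (eta * (m * t))))).
  rewrite (_ : n * _ = eta / 64 * (n * (m * t))); last by ring.
  by rewrite ler_wpM2l// divr_ge0// ltW.
rewrite ler_wpM2l//; first by lra.
lra.
Qed.

(** lam / (sqrt N mu) is the square root of (log p / log N)^3, and m_{N,T} is the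
    larger of this number and its inverse. *)
Lemma mNT_sqr (N T : nat) (lp lN la : R) : (0 < N)%N -> (0 < T)%N ->
    0 < lp -> 0 < lN -> 0 < la ->
  mNT N (Num.sqrt (4 * N%:R * T%:R * lp ^+ 3 * la ^+ 3))
    (Num.sqrt (4 * T%:R * lN ^+ 3 * la ^+ 3)) ^+ 2 =
  Num.max (lp / lN) (lN / lp) ^+ 3.
Proof.
move=> N0 T0 lp0 lN0 la0; pose q := lp / lN.
have q0 : 0 < q by rewrite divr_gt0.
have NR : 0 < N%:R :> R by rewrite ltr0n.
have TR : 0 < T%:R :> R by rewrite ltr0n.
set mu := Num.sqrt (4 * T%:R * _ * _); set lam := Num.sqrt _.
have mu0 : 0 < mu by rewrite sqrtr_gt0 !mulr_gt0 ?exprn_gt0.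
have rN0 : 0 < Num.sqrt N%:R :> R by rewrite sqrtr_gt0.
have rq0 : 0 < Num.sqrt (q ^+ 3) by rewrite sqrtr_gt0 exprn_gt0.
have -> : lam = Num.sqrt N%:R * mu * Num.sqrt (q ^+ 3).
  rewrite /lam /mu -!sqrtrM ?mulr_ge0 ?ltW ?mulr_gt0 ?exprn_gt0//.
  congr Num.sqrt; rewrite /q; field; lra.
rewrite /mNT -[lN / lp]invf_div -/q.
have Nmu0 : 0 < Num.sqrt N%:R * mu by rewrite mulr_gt0.
rewrite mulrC mulKf ?gt_eqF// invfM mulrA divff ?gt_eqF// mul1r.
have q2 : Num.sqrt (q ^+ 3) ^+ 2 = q ^+ 3 by rewrite sqr_sqrtr// exprn_ge0// ltW.
have [q1|q1] := leP 1 q.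
  have r1 : 1 <= Num.sqrt (q ^+ 3).
    by rewrite -(@expr_ge1 R 2)// ?q2 ?expr_ge1// ltW.
  rewrite !max_l//.
    by rewrite (le_trans _ q1)// invf_le1.
  by rewrite (le_trans _ r1)// invf_le1.
have r1 : Num.sqrt (q ^+ 3) <= 1.
  by rewrite -(@expr_le1 R 2)// ?q2 ?expr_le1// ltW.
rewrite !max_r ?exprVn ?q2//.
  by rewrite (le_trans (ltW q1))// invf_ge1// ltW.
by rewrite (le_trans r1)// invf_ge1.
Qed.

End rates.

(** * Deviation of Psi from Gamma *)

Section deviation.
Context {d : measure_display} {Om : measurableType d} {R : realType}.
Variables (P : probability Om R) (N T p : nat).
Variables (x : 'I_N -> 'I_T -> 'I_p -> {RV P >-> R}).
Variables (eps : 'I_N -> 'I_T -> {RV P >-> R}).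
Variables (C K : R) (i0 : 'I_N).
Hypotheses (T_gt0 : (0 < T)%N) (C_gt0 : 0 < C) (K_gt0 : 0 < K).
Hypothesis i00 : i0 = 0%N :> nat.
Hypotheses (A1 : assumption_A1 x eps) (A2 : assumption_A2b x eps C K).

Let M := exp_bound K.
Let D := 16 / (C / 2) ^+ 2 * M.
Let N_gt0 : (0 < N)%N. Proof. exact: leq_ltn_trans (ltn_ord i0). Qed.
Let NR : 0 < N%:R :> R. Proof. by rewrite ltr0n. Qed.

(** The first bound keeps h = eta min(1, t) within C/4, where [exp_moment_le]
    applies; the second makes eta D <= 1/64, as [gram_rate] requires. *)
Definition rate_eta : R := Num.min (C / 4) (64 * D)^-1.
(** The rates of the covariate entries and of the mixed entries; the latter is the
    exponent C/2 u^2 at u = sqrt N t / 32, divided by N t^2. *)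
Definition rate : R := Num.min (rate_eta / 64) (C / 2 / 32 ^+ 2).

Lemma rate_eta_gt0 : 0 < rate_eta.
Proof.
have M0 : 0 < M by exact: exp_bound_gt0.
rewrite lt_min divr_gt0//= invr_gt0 mulr_gt0// mulr_gt0// divr_gt0//.
by rewrite exprn_gt0// divr_gt0.
Qed.

Lemma rate_gt0 : 0 < rate.
Proof.
rewrite lt_min; apply/andP; split; first exact: divr_gt0 rate_eta_gt0 _.
by rewrite !divr_gt0// exprn_gt0.
Qed.

Definition deviation (i : 'I_p * 'I_p + 'I_N * 'I_p) (tau : R) : set Om :=
  match i with
  | inl (j, k) => [set w |
      tau <= `|N%:R^-1 * (\sum_i unit_gram x w i j k) - gram_mean x i0 j k|]
  | inr (i, k) => [set w | tau <= `|(Num.sqrt N%:R)^-1 * unit_mean x w i k|]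
  end.

Lemma measurable_deviation i tau : measurable (deviation i tau).
Proof.
case: i => -[a b]; rewrite -[X in measurable X]setTI /deviation;
  apply: measurable_fun_le => //; apply: measurableT_comp => //.
  apply: measurable_funB => //; apply: measurable_funM => //.
  by apply: measurable_sum => i; exact: measurable_unit_gram.
by apply: measurable_funM => //; exact: measurable_unit_mean.
Qed.

(** Covariate entries are treated by the Chernoff bound over units, mixed entries by
    Markov's inequality for exp (C/2 u^2), u being a within-unit mean. *)
Lemma prob_deviation_le i (t z : R) : 0 < t -> 0 <= z ->
    z ^+ 3 = t ^+ 2 * N%:R -> 1 <= t ^+ 2 * N%:R ->
  (P (deviation i (t / 32)) <= ((2 + M) * expR (- (rate * z)))%:E)%E.
Proof.
move=> t0 z0 z3 tn1.
have M0 : 0 < M by exact: exp_bound_gt0.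
have eta0 := rate_eta_gt0.
have N1 : 1 <= N%:R :> R by rewrite ler1n.
case: i => -[a b].
  pose h := rate_eta * Num.min 1 t.
  have h0 : 0 < h by rewrite mulr_gt0// lt_min ltr01.
  have hc : h <= C / 2 / 2.
    apply: (@le_trans _ _ (rate_eta * 1)).
      by rewrite ler_pM2l// ge_min lexx.
    by rewrite mulr1 ge_min; apply/orP; left; lra.
  rewrite /deviation (_ : mkset _ = [set w | t / 32 <= `|N%:R^-1 *
      (\sum_i gram_fun a b (unit_elt x eps i w))
      - gram_mean x i0 a b|]); last first.
    apply: eq_set => w; congr (is_true (_ <= `|_ * _ - _|)).
    by apply: eq_bigr => i _; rewrite gram_funE.
  have gE i w : gram_fun a b (unit_elt x eps i w) = unit_gram x w i a b.
    exact: gram_funE.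
  have g_exp i : (\int[P]_w (expR (C / 2 *
      `|gram_fun a b (unit_elt x eps i w)|))%:E <= M%:E)%E.
    under eq_integral do rewrite gE.
    exact: (unit_gram_moment T_gt0 C_gt0 K_gt0 i00 A1 A2).
  have g_mean i : (\int[P]_w (gram_fun a b (unit_elt x eps i w))%:E =
      (gram_mean x i0 a b)%:E)%E.
    under eq_integral do rewrite gE.
    exact: (unit_gram_meanE T_gt0 C_gt0 K_gt0 i00 A1 A2).
  have C2 : 0 < C / 2 by rewrite divr_gt0.
  have hb : 0 < h <= C / 2 / 2 by rewrite h0.
  apply: (le_trans (chernoff_two_sided N_gt0 (measurable_unit_elt x eps)
    (unit_elt_indep A1) C2 (measurable_gram_fun a b) g_exp g_mean (t / 32) hb)).
  rewrite lee_fin; apply: ler_pM; rewrite ?expR_ge0//; first by lra.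
  rewrite ler_expR lerN2 -/D.
  have D0 : 0 < D by rewrite mulr_gt0// divr_gt0// exprn_gt0// divr_gt0.
  apply: le_trans (gram_rate t0 N1 z0 z3 tn1 eta0 (ltW D0) _).
    by rewrite ler_wpM2r// /rate ge_min lexx.
  apply: (@le_trans _ _ ((64 * D)^-1 * D)).
    by rewrite ler_pM2r// /rate_eta ge_min lexx orbT.
  by rewrite invfM mulfVK// gt_eqF.
pose f w := expR (- (C / 2 / 32 ^+ 2 * z)) * expR (C / 2 * unit_mean x w a b ^+ 2).
have mf : measurable_fun setT (fun w => expR (C / 2 * unit_mean x w a b ^+ 2)).
  apply: measurableT_comp => //; apply: measurable_funM => //.
  by apply: measurable_funX; exact: measurable_unit_mean.
apply: (@le_trans _ _ (\int[P]_w (f w)%:E)%E).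
  apply: le_prob_integral.
  - exact: (measurable_deviation (inr (a, b))).
  - exact: measurable_funM.
  - by move=> w; rewrite mulr_ge0 ?expR_ge0.
  move=> w /=; rewrite normrM ger0_norm ?invr_ge0 ?sqrtr_ge0//.
  rewrite ler_pdivlMl ?sqrtr_gt0// => tw.
  rewrite /f -expRD -[leLHS](@expR0 R) ler_expR addrC subr_ge0.
  have : (Num.sqrt N%:R * (t / 32)) ^+ 2 <= `|unit_mean x w a b| ^+ 2.
    by rewrite ler_pXn2r ?nnegrE// mulr_ge0 ?sqrtr_ge0// divr_ge0// ltW.
  rewrite exprMn sqr_sqrtr ?ler0n// real_normK ?num_real// => h.
  have zz : z <= t ^+ 2 * N%:R.
    rewrite -z3 exprS ler_peMr// expr_ge1//.
    by rewrite -(@expr_ge1 R 3)// z3.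
  apply: (@le_trans _ _ (C / 2 * (N%:R * (t / 32) ^+ 2))).
    rewrite [leRHS](_ : _ = C / 2 / 32 ^+ 2 * (t ^+ 2 * N%:R)); last by field.
    by rewrite ler_pM2l// !divr_gt0// exprn_gt0.
  by rewrite ler_pM2l// divr_gt0.
rewrite /f; under eq_integral do rewrite EFinM.
rewrite ge0_integralZl_EFin ?expR_ge0//; last exact/measurable_EFinP.
apply: (@le_trans _ _ ((expR (- (C / 2 / 32 ^+ 2 * z)))%:E * M%:E)%E).
  apply: lee_wpmul2l; first by rewrite lee_fin expR_ge0.
  exact: (unit_mean_moment T_gt0 C_gt0 K_gt0 i00 A1 A2).
rewrite -EFinM lee_fin mulrC; apply: ler_pM; rewrite ?expR_ge0//; [exact: ltW|lra|].
by rewrite ler_expR lerN2 ler_wpM2r// /rate ge_min lexx orbT.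
Qed.

Lemma measurable_Psi i j : measurable_fun setT (fun w => Psi x w i j).
Proof.
under eq_fun do rewrite PsiE//.
case: (split_ordP i) => i' ->; case: (split_ordP j) => j' ->.
- under eq_fun do rewrite block_mxEul mxE.
  apply: measurable_funM => //; apply: measurable_sum => k.
  exact: measurable_unit_gram.
- under eq_fun do rewrite block_mxEur mxE.
  by apply: measurable_funM => //; exact: measurable_unit_mean.
- under eq_fun do rewrite block_mxEdl mxE.
  by apply: measurable_funM => //; exact: measurable_unit_mean.
- under eq_fun do rewrite block_mxEdr.
  exact: measurable_cst.
Qed.

Lemma Psi_deviation w (tau : R) : 0 <= tau ->
    (forall i, ~ deviation i tau w) ->
  forall i j, `|Psi x w i j - Gamma x i j| <= tau.
Proof.
move=> tau0 nd i j; rewrite PsiE// (GammaE T_gt0 C_gt0 K_gt0 i00 A1 A2).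
have nd1 j' k : `|N%:R^-1 * (\sum_i unit_gram x w i j' k) - gram_mean x i0 j' k| <= tau.
  by rewrite leNgt; apply/negP => /ltW; exact: (nd (inl (j', k))).
have nd2 i' k : `|(Num.sqrt N%:R)^-1 * unit_mean x w i' k| <= tau.
  by rewrite leNgt; apply/negP => /ltW; exact: (nd (inr (i', k))).
case: (split_ordP i) => i' ->; case: (split_ordP j) => j' ->.
- by rewrite !block_mxEul !mxE.
- by rewrite !block_mxEur !mxE subr0.
- by rewrite !block_mxEdl !mxE subr0.
- by rewrite !block_mxEdr subrr normr0.
Qed.

(** The numbers of covariate and of mixed entries are p^2 and N p; the mixed block
    is counted once since Psi is symmetric. *)
Lemma Gamma_deviation_prob (B : set Om) (t z : R) : measurable B ->
    0 < t -> 0 <= z -> z ^+ 3 = t ^+ 2 * N%:R -> 1 <= t ^+ 2 * N%:R ->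
    (forall w, (forall i j, `|Psi x w i j - Gamma x i j| <= t / 32) -> B w) ->
  ((1 - (2 + M) * (p%:R ^+ 2 + N%:R * p%:R) * expR (- (rate * z)))%:E
    <= P B)%E.
Proof.
move=> mB t0 z0 z3 tn1 inB.
have := @union_bound _ _ _ P _ (fun i => deviation i (t / 32)) (~` B)
  ((2 + M) * expR (- (rate * z))) (measurableC mB)
  (fun i => measurable_deviation i _) _
  (fun i => prob_deviation_le i t0 z0 z3 tn1).
rewrite probability_setC// card_sum !card_prod !card_ord natrD !natrM => H.
have {}H : (1 - P B <= ((p%:R * p%:R + N%:R * p%:R) *
    ((2 + M) * expR (- (rate * z))))%:E)%E.
  apply: H => w nBw; apply: contrapT => /forallNP nd; apply: nBw; apply: inB.
  by apply: Psi_deviation nd; rewrite divr_ge0// ltW.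
move: H; rewrite -(fineK (fin_num_measure P _ mB)) -EFinB !lee_fin; lra.
Qed.

End deviation.

(** * Restricted eigenvalue of the random matrix *)

Lemma BtildeE {d : measure_display} {Om : measurableType d} {R : realType}
    (P : probability Om R) (N T p : nat) (x : 'I_N -> 'I_T -> 'I_p -> {RV P >-> R})
    (s1 s2 : nat) (lam mu b : R) :
  kappa2 T s1 s2 lam mu (Gamma x) / (32 * (s1 + s2)%:R * mNT N lam mu ^+ 2) = b ->
  0 <= b ->
  Btilde x s1 s2 lam mu =
    [set w | forall i j, `|Psi x w i j - Gamma x i j| <= b].
Proof.
move=> <- b0; apply/seteqP; split => w /= h.
  move=> i j; apply: le_trans h.
  apply: le_trans (le_bigmax _ _ i).
  exact: (le_bigmax _ (fun j => `|Psi x w i j - Gamma x i j|) j).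
by do 2!apply: bigmax_le => // ? _.
Qed.

Theorem lemma7 (R : realType) (C K : R) (C_gt0 : 0 < C) (K_gt0 : 0 < K) :
  exists A B : R, [/\ 0 < A, 0 < B &
  forall (d : measure_display) (Omega : measurableType d)
    (P : probability Omega R) (N T p : nat)
    (x : 'I_N -> 'I_T -> 'I_p -> {RV P >-> R})
    (eps : 'I_N -> 'I_T -> {RV P >-> R})
    (y : 'I_N -> 'I_T -> Omega -> R)
    (beta : 'cV[R]_p) (c : 'cV[R]_N) (a : R),
  expR 1 <= p%:R :> R -> expR 1 <= N%:R :> R -> (1 <= T)%N ->
  expR 1 <= a ->
  panel_model x eps y beta c ->
  assumption_A1 x eps ->
  assumption_A2b x eps C K ->
  let s1 := nb_nonzero beta in
  let s2 := nb_nonzero c in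
  let lam := Num.sqrt (4 * N%:R * T%:R * ln p%:R ^+ 3 * ln a ^+ 3) in
  let mu := Num.sqrt (4 * T%:R * ln N%:R ^+ 3 * ln a ^+ 3) in
  let kap2 := kappa2 T s1 s2 lam mu in
  let t := kap2 (Gamma x) /
    ((s1 + s2)%:R * Num.max (ln p%:R / ln N%:R) (ln N%:R / ln p%:R) ^+ 3) in
  1 <= N%:R * t ^+ 2 ->
  (P (Btilde x s1 s2 lam mu)
     <= P [set w | (kap2 (Gamma x) / 2 <= kap2 (Psi x w))%R])%E /\
  ((1 - A * (p%:R ^+ 2 + N%:R * p%:R)
        * expR (- (B * powR (t ^+ 2 * N%:R) 3^-1)))%:E
     <= P (Btilde x s1 s2 lam mu))%E].
Proof.
exists (2 + exp_bound K), (rate C K); split.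
- exact: addr_gt0 (exp_bound_gt0 K_gt0).
- exact: rate_gt0.
move=> d Omega P N T p x eps y beta c a pe Ne T_gt0 ae _ A1 A2.
move=> s1 s2 lam mu kap2 t tN.
have lnge1 (r : R) : expR 1 <= r -> 0 < ln r.
  move=> re; apply: lt_le_trans ltr01 _.
  by rewrite -[leLHS](expRK 1) ler_ln// posrE ?expR_gt0// (lt_le_trans (expR_gt0 1)).
have lp0 : 0 < ln p%:R :> R := lnge1 _ pe.
have lN0 : 0 < ln N%:R :> R := lnge1 _ Ne.
have la0 : 0 < ln a := lnge1 _ ae.
have N_gt0 : (0 < N)%N by rewrite -(ltr0n R) (lt_le_trans (expR_gt0 1)).
have NR : 0 < N%:R :> R by rewrite ltr0n.
have TR : 0 < T%:R :> R by rewrite ltr0n.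
have lam0 : 0 < lam by rewrite sqrtr_gt0 !mulr_gt0 ?exprn_gt0.
have mu0 : 0 < mu by rewrite sqrtr_gt0 !mulr_gt0 ?exprn_gt0.
pose i0 := Ordinal N_gt0; have i00 : i0 = 0%N :> nat by [].
(* The hypothesis N t^2 >= 1 only controls |t|: positivity of t comes from Gamma
   being positive semi-definite. *)
have k0 : 0 <= kap2 (Gamma x).
  by apply: kappa2_ge0 => v; exact: (Gamma_psd T_gt0 C_gt0 K_gt0 i00 A1 A2).
have t_neq0 : t != 0.
  by apply: contraL tN => /eqP ->; rewrite expr0n mulr0 ler10.
have t0 : 0 < t.
  rewrite lt_def t_neq0 divr_ge0// mulr_ge0// exprn_ge0// le_max.
  by rewrite (ltW (divr_gt0 lp0 lN0)).
have s_gt0 : (0 < s1 + s2)%N.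
  by rewrite lt0n; apply: contraNneq t_neq0 => s0; rewrite /t s0 mul0r invr0 mulr0.
have bound : kap2 (Gamma x) / (32 * (s1 + s2)%:R * mNT N lam mu ^+ 2) = t / 32.
  rewrite (mNT_sqr N_gt0 T_gt0 lp0 lN0 la0) /t -mulrA [X in _ / X]mulrC invfM mulrA.
  by [].
have t32 : 0 <= t / 32 by rewrite divr_ge0// ltW.
have BE := BtildeE bound t32.
have mPsi := measurable_Psi x i0 T_gt0.
have mB : measurable (Btilde x s1 s2 lam mu).
  rewrite BE (_ : mkset _ = \bigcap_(i in setT) \bigcap_(j in setT)
      [set w | `|Psi x w i j - Gamma x i j| <= t / 32]); last first.
    by apply/seteqP; split => w /= h i => [_ j _|j]; exact: h.
  apply: fin_bigcap_measurable => // i _; apply: fin_bigcap_measurable => // j _.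
  rewrite -[X in measurable X]setTI; apply: measurable_fun_le => //.
  apply: measurableT_comp => //; exact: measurable_funB.
have mK : measurable [set w | kap2 (Gamma x) / 2 <= kap2 (Psi x w)].
  apply: (measurable_lipschitz_ge (F := Psi x) (g := kap2)) => // M G.
  exact: kappa2_lipschitz.
split.
  apply: le_measure; rewrite ?inE//.
  rewrite BE => w /= h; apply: kappa2_half => // i j.
  by rewrite -/(kap2 _) bound.
have z0 : 0 <= powR (t ^+ 2 * N%:R) 3^-1 by exact: powR_ge0.
have tN' : 1 <= t ^+ 2 * N%:R by rewrite mulrC.
have z3 : powR (t ^+ 2 * N%:R) 3^-1 ^+ 3 = t ^+ 2 * N%:R.
  by rewrite cube_root// (le_trans _ tN').
apply: (Gamma_deviation_prob T_gt0 C_gt0 K_gt0 i00 A1 A2 mB t0 z0 z3 tN').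
by rewrite BE.
Qed.
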